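(* Let $n\geq 3$ and let $V:f=0$ be a reduced hypersurface of degree $d$ in $\mathbb{P}^{n-1}$, where $f\in \mathbb{C}[x_1,\dots,x_n]$ is a homogeneous polynomial of degree $d$ which essentially involves the $n$ variables $x_1,\dots,x_n$ and has Waring rank $n+1$. Then, up to a linear change of coordinates, there is a unique integer $k$ with $2\leq k\leq n$ such that $$V:\ f=x_1^d+\cdots+x_n^d+(a_1x_1+\cdots+a_kx_k)^d=0$$ for some $a=(a_1,\dots,a_k)\in(\mathbb{C}^* )^k$. Moreover, with $V$ written in this form, the following hold. (1) $V$ is singular if and only if $R_k(a)=0$, where $R_k(a)$ is the resultant of the system $(S)$ of $k$ equations in the $k-1$ indeterminates $u=(u_1,\dots,u_{k-1})$ given by $$g_j(u)=a_ku_j^{d-1}-a_j=0\quad\text{for } j=1,\dots,k-1,$$ $$g_k(u)=a_k(a_1u_1+\cdots+a_{k-1}u_{k-1}+a_k)^{d-1}+1=0.$$ (2) If $V$ is singular, then $V$ has only isolated singularities, and each of them is of type $A_{2^{k-1},d^{n-k}}$, that is, given in suitable local (analytic) coordinates by the equation $$v_1^2+\cdots+v_{k-1}^2+w_1^d+\cdots+w_{n-k}^d=0.$$ In particular, $V$ is irreducible for $n\geq 4$. (3) These singularities are located at the points $(u^0:1:0:\dots:0)\in\mathbb{P}^{n-1}$ (with $1$ in the $k$-th coordinate), where $u^0=(u_1^0,\dots,u_{k-1}^0)$ is a solution of the system $(S)$. In particular, $$\mu(V)=\tau(V)=N(S)(d-1)^{n-k},$$ where $N(S)$ is the number of solutions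 of the system $(S)$.
   Context: All polynomials and varieties are over $\mathbb{C}$. The Waring rank of a homogeneous polynomial $f$ of degree $d$ is the minimal $r$ such that $f=\ell_1^d+\cdots+\ell_r^d$ for linear forms $\ell_1,\dots,\ell_r$. The form $f$ essentially involves the variables $x_1,\dots,x_n$ if it cannot be written, after a linear change of coordinates, as a polynomial in fewer than $n$ variables; equivalently, the linear forms in any Waring decomposition of $f$ of minimal length span the space of all linear forms in $x_1,\dots,x_n$. For a projective hypersurface $V$ with only isolated singularities, $\mu(V)$ (resp. $\tau(V)$) denotes the global Milnor (resp. Tjurina) number, i.e. the sum of the local Milnor numbers $\mu(V,p)$ (resp. local Tjurina numbers $\tau(V,p)$) over all singular points $p\in V$. The resultant of $k$ polynomials of degree $d-1$ in $k-1$ indeterminates is the usual multivariate resultant (of their homogenizations to degree $d-1$); only its vanishing matters here. *)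

(* Defs.v *)
From HB Require Import structures.
From mathcomp Require Import all_boot all_order all_algebra.
From mathcomp Require Import boolp reals.
From mathcomp Require Import complex.
From mathcomp Require Import mpoly.

Set Implicit Arguments.
Unset Strict Implicit.
Unset Printing Implicit Defensive.

Import Order.TTheory GRing.Theory Num.Theory.

Local Open Scope ring_scope.

Definition fps (m : nat) (K : Type) : Type := 'X_{1..m} -> K.

HB.instance Definition _ (m : nat) (K : Type) := gen_eqMixin (fps m K).
HB.instance Definition _ (m : nat) (K : Type) := gen_choiceMixin (fps m K).

Section FormalPowerSeries.
Variables (m : nat) (K : comNzRingType).
Implicit Types f g h : fps m K.

Definition fps_zero : fps m K := fun=> 0.
Definition fps_opp f : fps m K := fun a => - f a.
Definition fps_add f g : fps m K := fun a => f a + g a.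

Lemma fps_addA : associative fps_add.
Proof. by move=> f g h; apply/funext => a; rewrite /fps_add addrA. Qed.

Lemma fps_addC : commutative fps_add.
Proof. by move=> f g; apply/funext => a; rewrite /fps_add addrC. Qed.

Lemma fps_add0 : left_id fps_zero fps_add.
Proof. by move=> f; apply/funext => a; rewrite /fps_add add0r. Qed.

Lemma fps_addN : left_inverse fps_zero fps_opp fps_add.
Proof. by move=> f; apply/funext => a; rewrite /fps_add addNr. Qed.

HB.instance Definition _ :=
  Algebra.isZmodule.Build (fps m K) fps_addA fps_addC fps_add0 fps_addN.

Lemma fps_coefD f g a : (f + g) a = f a + g a. Proof. by []. Qed.
Lemma fps_coefN f a : (- f) a = - f a. Proof. by []. Qed.

Definition fps_of_mpoly (p : {mpoly K[m]}) : fps m K := fun a => p@_a.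

Definition fps_mul f g : fps m K := fun a =>
  \sum_(k : 'X_{1..m < (mdeg a).+1, (mdeg a).+1} | a == (k.1 + k.2)%MM)
    f k.1 * g k.2.

Definition fps_trunc (b : nat) f : {mpoly K[m]} :=
  \sum_(a : 'X_{1..m < b}) f a *: 'X_[a].

Lemma fps_truncE b f a : (fps_trunc b f)@_a = if (mdeg a < b)%N then f a else 0.
Proof.
rewrite /fps_trunc raddf_sum /=; case: ifPn => [ha|ha].
  rewrite (bigD1 (BMultinom ha)) //= big1 ?addr0.
    by rewrite mcoeffZ mcoeffX eqxx mulr1.
  move=> c hc; rewrite mcoeffZ mcoeffX; case: eqP => [e|]; last by rewrite mulr0.
  by case/negP: hc; apply/eqP/val_inj.
rewrite big1 // => c _; rewrite mcoeffZ mcoeffX; case: eqP => [e|]; last by rewrite mulr0.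
by case/negP: ha; rewrite -e bmdeg.
Qed.

Lemma mcoeffM_eq (p q p' q' : {mpoly K[m]}) (b : nat) :
  (forall a, (mdeg a < b)%N -> p@_a = p'@_a) ->
  (forall a, (mdeg a < b)%N -> q@_a = q'@_a) ->
  forall a, (mdeg a < b)%N -> (p * q)@_a = (p' * q')@_a.
Proof.
move=> hp hq a ha; rewrite !mcoeffM; apply: eq_bigr => k _.
by rewrite hp ?hq //; apply: leq_trans (bmdeg _) ha.
Qed.

Lemma fps_mulE b f g a : (mdeg a < b)%N ->
  fps_mul f g a = (fps_trunc b f * fps_trunc b g)@_a.
Proof.
move=> ha; rewrite mcoeffM; apply: eq_bigr => k _.
by rewrite !fps_truncE !(leq_trans (bmdeg _) ha).
Qed.

Lemma fps_mulC : commutative fps_mul.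
Proof.
by move=> f g; apply/funext => a; rewrite !(@fps_mulE (mdeg a).+1) // mulrC.
Qed.

Lemma fps_mulA : associative fps_mul.
Proof.
move=> f g h; apply/funext => a; rewrite !(@fps_mulE (mdeg a).+1) //.
rewrite (@mcoeffM_eq _ _ (fps_trunc (mdeg a).+1 f)
  (fps_trunc (mdeg a).+1 g * fps_trunc (mdeg a).+1 h) (mdeg a).+1) //; last first.
  by move=> c hc; rewrite fps_truncE hc (fps_mulE _ _ hc).
rewrite mulrA; apply: (@mcoeffM_eq _ _ _ _ (mdeg a).+1) => // c hc.
by rewrite fps_truncE hc (fps_mulE _ _ hc).
Qed.

Definition fps_one : fps m K := fps_of_mpoly 1.

Lemma fps_mul1 : left_id fps_one fps_mul.
Proof.
move=> f; apply/funext => a; rewrite (@fps_mulE (mdeg a).+1) //.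
rewrite (@mcoeffM_eq _ _ 1 (fps_trunc (mdeg a).+1 f) (mdeg a).+1) //.
  by rewrite mul1r fps_truncE leqnn.
by move=> c hc; rewrite fps_truncE hc.
Qed.

Lemma fps_mulD : left_distributive fps_mul +%R.
Proof.
move=> f g h; apply/funext => a; rewrite fps_coefD !(@fps_mulE (mdeg a).+1) //.
rewrite -mcoeffD -mulrDl; apply: (@mcoeffM_eq _ _ _ _ (mdeg a).+1) => // c hc.
by rewrite mcoeffD !fps_truncE hc.
Qed.

Lemma fps_one_neq0 : fps_one != 0.
Proof.
apply/eqP => /(congr1 (fun f : fps m K => f 0%MM)).
by rewrite /fps_one /fps_of_mpoly mcoeff1 eqxx => /eqP; rewrite oner_eq0.
Qed.

HB.instance Definition _ := GRing.Zmodule_isComNzRing.Build (fps m K)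
  fps_mulA fps_mulC fps_mul1 fps_mulD fps_one_neq0.

End FormalPowerSeries.

Section ConvergentPowerSeries.
Variables (m : nat) (K : numFieldType).
Implicit Types f g : fps m K.

(* Absolute convergence at the point (r, ..., r). *)
Definition convergent f : Prop := exists r M : K, 0 < r /\
  forall b, \sum_(a : 'X_{1..m < b}) `|f a| * r ^+ mdeg a <= M.

Definition convergent_pred : {pred fps m K} := fun f => `[< convergent f >].

Lemma convergent_radius f : convergent f -> exists r M : K, 0 < r /\
  forall s, 0 <= s <= r ->
  forall b, \sum_(a : 'X_{1..m < b}) `|f a| * s ^+ mdeg a <= M.
Proof.
move=> [r [M [r0 hM]]]; exists r, M; split=> // s /andP[s0 sr] b.
apply: le_trans (hM b); apply: ler_sum => a _; apply: ler_wpM2l => //.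
by apply: lerXn2r => //; rewrite nnegrE // ltW.
Qed.

Lemma convergent_common f g : convergent f -> convergent g ->
  exists r M N : K, 0 < r /\ forall b,
    \sum_(a : 'X_{1..m < b}) `|f a| * r ^+ mdeg a <= M /\
    \sum_(a : 'X_{1..m < b}) `|g a| * r ^+ mdeg a <= N.
Proof.
move=> /convergent_radius[r [M [r0 hM]]] /convergent_radius[s [N [s0 hN]]].
have [rs|sr] := orP (real_leVge (gtr0_real r0) (gtr0_real s0)).
  exists r, M, N; split=> // b; split; [apply: hM | apply: hN].
    by rewrite lexx ltW.
  by rewrite rs ltW.
exists s, M, N; split=> // b; split; [apply: hM | apply: hN].
  by rewrite sr ltW.
by rewrite lexx ltW.
Qed.

Lemma convergent_mpoly (p : {mpoly K[m]}) : convergent (fps_of_mpoly p).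
Proof.
exists 1, (\sum_(a <- msupp p) `|p@_a|); split=> // b.
under eq_bigr do rewrite expr1n mulr1.
rewrite -(big_map (fun a : 'X_{1..m < b} => (a : 'X_{1..m})) xpredT
  (fun a => `|fps_of_mpoly p a|)).
set s := map _ _; have us : uniq s.
  by rewrite map_inj_uniq ?index_enum_uniq //; apply: val_inj.
rewrite (bigID (fun a => a \in msupp p)) /= [X in _ + X]big1 ?addr0; last first.
  by move=> a /memN_msupp_eq0 e; rewrite /fps_of_mpoly e normr0.
rewrite -big_filter.
have us' : uniq [seq a <- s | a \in msupp p] by rewrite filter_uniq.
rewrite [leRHS](bigID (fun a => a \in s)) /= -[X in _ <= X + _]big_filter.
rewrite (perm_big [seq a <- msupp p | a \in s]) /=.
  by rewrite lerDl sumr_ge0.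
apply: uniq_perm => //; first by rewrite filter_uniq ?msupp_uniq.
by move=> a; rewrite !mem_filter andbC.
Qed.

Lemma convergentB f g : convergent f -> convergent g -> convergent (f - g).
Proof.
move=> cf cg; have [r [M [N [r0 h]]]] := convergent_common cf cg.
exists r, (M + N); split=> // b; have [h1 h2] := h b.
apply: le_trans (lerD h1 h2); rewrite -big_split /=; apply: ler_sum => a _.
rewrite -mulrDl; apply: ler_wpM2r; first by rewrite exprn_ge0 // ltW.
by rewrite fps_coefD fps_coefN; apply: ler_normB.
Qed.

Lemma mcoeff_sum_le (p : {mpoly K[m]}) b : (forall a, 0 <= p@_a) ->
  \sum_(a : 'X_{1..m < b}) p@_a <= p.@[fun=> 1].
Proof.
move=> hp; rewrite mevalE.
have -> : \sum_(a <- msupp p) p@_a * \prod_(i < m) 1 ^+ a i = \sum_(a <- msupp p) p@_a.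
  by apply: eq_bigr => a _; rewrite big1 ?mulr1 // => i _; rewrite expr1n.
rewrite -(big_map (fun a : 'X_{1..m < b} => (a : 'X_{1..m})) xpredT
  (fun a => p@_a)).
set s := map _ _; have us : uniq s.
  by rewrite map_inj_uniq ?index_enum_uniq //; apply: val_inj.
rewrite (bigID (fun a => a \in msupp p)) /= [X in _ + X]big1 ?addr0; last first.
  by move=> a /memN_msupp_eq0.
rewrite -big_filter [leRHS](bigID (fun a => a \in s)) /=.
rewrite -[X in _ <= X + _]big_filter.
rewrite (perm_big [seq a <- msupp p | a \in s]) /=.
  by rewrite lerDl sumr_ge0.
apply: uniq_perm; rewrite ?filter_uniq ?msupp_uniq //.
by move=> a; rewrite !mem_filter andbC.
Qed.

Lemma convergentM f g : convergent f -> convergent g -> convergent (f * g).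
Proof.
move=> cf cg; have [r [M [N [r0 h]]]] := convergent_common cf cg.
exists r, (M * N); split=> // b; have [h1 h2] := h b.
pose F : fps m K := fun a => `|f a| * r ^+ mdeg a.
pose G : fps m K := fun a => `|g a| * r ^+ mdeg a.
have F0 a : 0 <= F a by rewrite mulr_ge0 // exprn_ge0 // ltW.
have G0 a : 0 <= G a by rewrite mulr_ge0 // exprn_ge0 // ltW.
have T1 (H : fps m K) : (fps_trunc b H).@[fun=> 1] = \sum_(a : 'X_{1..m < b}) H a.
  rewrite /fps_trunc raddf_sum /=; apply: eq_bigr => a _.
  by rewrite mevalZ mevalX big1 ?mulr1 // => i _; rewrite expr1n.
have hFG : (fps_trunc b F * fps_trunc b G).@[fun=> 1] <= M * N.
  by rewrite mevalM !T1; apply: ler_pM => //; apply: sumr_ge0.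
apply: le_trans hFG; apply: le_trans (mcoeff_sum_le b _); last first.
  move=> a; rewrite mcoeffM sumr_ge0 // => k _.
  by rewrite !fps_truncE mulr_ge0 //; case: ifP.
apply: ler_sum => a _; rewrite -(@fps_mulE m K b F G a) ?bmdeg //.
apply: (@le_trans _ _ ((\sum_(k : 'X_{1..m < (mdeg a).+1, (mdeg a).+1} |
  bmnm a == (k.1 + k.2)%MM) `|f k.1 * g k.2|) * r ^+ mdeg a)).
  apply: ler_wpM2r; first by rewrite exprn_ge0 // ltW.
  exact: ler_norm_sum.
rewrite mulr_suml; apply: ler_sum => k /eqP e.
have -> : r ^+ mdeg a = r ^+ mdeg k.1 * r ^+ mdeg k.2 by rewrite -exprD -mdegD -e.
by rewrite normrM /F /G mulrACA.
Qed.

Lemma convergent_subring : subring_closed convergent_pred.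
Proof.
split; first exact/asboolP/(convergent_mpoly 1).
  by move=> f g /asboolP cf /asboolP cg; apply/asboolP/convergentB.
by move=> f g /asboolP cf /asboolP cg; apply/asboolP/convergentM.
Qed.

HB.instance Definition _ :=
  GRing.isSubringClosed.Build (fps m K) convergent_pred convergent_subring.

(* The local ring of convergent power series in m variables. *)
Record cps : Type := Cps { cps_val :> fps m K; _ : cps_val \in convergent_pred }.

HB.instance Definition _ := [isSub for cps_val].
HB.instance Definition _ := [Choice of cps by <:].
HB.instance Definition _ := [SubChoice_isSubComNzRing of cps by <:].

Definition cps_of_mpoly (p : {mpoly K[m]}) : cps :=
  Cps (introT (asboolP _) (convergent_mpoly p)).

End ConvergentPowerSeries.

Section Forms.
Variables (n : nat) (K : numFieldType).
Implicit Types (f : {mpoly K[n]}) (p q : 'rV[K]_n).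

Definition linear_form (l : 'rV[K]_n) : {mpoly K[n]} :=
  \sum_(j < n) l 0 j *: 'X_j.

Definition linear_subst (A : 'M[K]_n) f : {mpoly K[n]} :=
  f \mPo [tuple linear_form (row i A) | i < n].

Definition sum_of_powers (d : nat) f (r : nat) : Prop :=
  exists l : 'I_r -> 'rV[K]_n, f = \sum_(i < r) linear_form (l i) ^+ d.

Definition waring_rank (d : nat) f (r : nat) : Prop :=
  sum_of_powers d f r /\ forall s, sum_of_powers d f s -> (r <= s)%N.

(* In every linear coordinate system all n variables occur. *)
Definition essentially_involves_all f : Prop :=
  forall A, A \in unitmx -> forall i : 'I_n,
  exists2 a, a \in msupp (linear_subst A f) & a i != 0%N.

(* [msize p <= 1] means that p is constant. *)
Definition reduced f : Prop :=
  f != 0 /\ forall g h, f = g ^+ 2 * h -> (msize g <= 1)%N.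

Definition irreducible_mpoly f : Prop :=
  (1 < msize f)%N /\
  forall g h, f = g * h -> (msize g <= 1)%N \/ (msize h <= 1)%N.

(* Points of the projective space are nonzero vectors up to [proj_eq]. *)
Definition proj_eq p q : Prop := exists2 c : K, c != 0 & q = c *: p.

Definition singular_point f p : Prop :=
  [/\ p != 0, f.@[p 0] = 0 & forall i, (f^`M(i)).@[p 0] = 0].

Definition singular f : Prop := exists p, singular_point f p.

Definition isolated_singularity f p : Prop := exists i, p 0 i != 0 /\
  exists2 eps : K, 0 < eps & forall q, singular_point f q -> q 0 i != 0 ->
  (forall j, `|q 0 j / q 0 i - p 0 j / p 0 i| < eps) -> proj_eq p q.

(* Equation of f = 0 in the affine chart x_i = 1, in the n - 1 remaining
   coordinates, translated so that p becomes the origin. *)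
Definition local_equation f p (i : 'I_n) : {mpoly K[n.-1]} :=
  f \mPo [tuple if unlift i j is Some j' then (p 0 j / p 0 i)%:MP + 'X_j' else 1
          | j < n].

End Forms.

Section LocalAlgebra.
Variables (m : nat) (K : numFieldType).

Definition in_ideal (gens : seq (cps m K)) (g : cps m K) : Prop :=
  exists c : 'I_(size gens) -> cps m K, g = \sum_(i < size gens) c i * gens`_i.

(* The quotient by the ideal has dimension N: the classes of e form a basis. *)
Definition quotient_dim (gens : seq (cps m K)) (N : nat) : Prop :=
  exists e : 'I_N -> cps m K, forall g, exists! c : 'rV[K]_N,
  in_ideal gens (g - \sum_(i < N) cps_of_mpoly (c 0 i)%:MP * e i).

Definition jacobian_gens (g : {mpoly K[m]}) : seq (cps m K) :=
  [seq cps_of_mpoly g^`M(i) | i <- enum 'I_m].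

(* Inverse function theorem: such power series are local analytic coordinates
   at the origin. *)
Definition analytic_coordinates (y : 'I_m -> cps m K) : Prop :=
  (forall i, cps_val (y i) 0%MM = 0) /\ \matrix_(i, j) cps_val (y i) U_(j)%MM \in unitmx.

End LocalAlgebra.

Section Singularities.
Variables (n : nat) (K : numFieldType).
Implicit Types (f : {mpoly K[n]}) (p : 'rV[K]_n).

(* v_1^2 + ... + v_q^2 + w_1^d + ... + w_(n-1-q)^d = 0, where v and w together
   are the n - 1 coordinates y; the ideals of the two germs agree. *)
Definition has_type_A (q d : nat) f p : Prop := exists i, p 0 i != 0 /\
  exists y : 'I_n.-1 -> cps n.-1 K, analytic_coordinates y /\
  exists w w' : cps n.-1 K, w * w' = 1 /\
  cps_of_mpoly (local_equation f p i) =
    w * (\sum_(j < n.-1 | (j < q)%N) y j ^+ 2 +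
         \sum_(j < n.-1 | (q <= j)%N) y j ^+ d).

Definition local_milnor f p (N : nat) : Prop := exists i, p 0 i != 0 /\
  quotient_dim (jacobian_gens (local_equation f p i)) N.

Definition local_tjurina f p (N : nat) : Prop := exists i, p 0 i != 0 /\
  quotient_dim (cps_of_mpoly (local_equation f p i) ::
                jacobian_gens (local_equation f p i)) N.

(* N is the sum of the finite local numbers over the singular points, each
   represented by exactly one vector of the list s. *)
Definition sum_over_singular_points (loc : 'rV[K]_n -> nat -> Prop) f (N : nat)
    : Prop :=
  exists (s : seq 'rV[K]_n) (num : 'rV[K]_n -> nat),
  [/\ uniq s /\ {in s &, forall p q, proj_eq p q -> p = q},
      forall p, p \in s -> singular_point f p,
      forall q, singular_point f q -> exists2 p, p \in s & proj_eq p q,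
      forall p, p \in s -> loc p (num p) &
      N = (\sum_(p <- s) num p)%N].

Definition milnor_number f N := sum_over_singular_points (local_milnor f) f N.
Definition tjurina_number f N := sum_over_singular_points (local_tjurina f) f N.

End Singularities.

Section Resultant.
Variables (r e : nat).

Definition coef_index : finType :=
  ('I_r * {a : 'X_{1..r < e.+1} | mdeg a == e})%type.

Section Value.
Variable K : comNzRingType.

Definition resultant_value (Res : {mpoly int[#|coef_index|]})
    (G : 'I_r -> {mpoly K[r]}) : K :=
  (map_mpoly intr Res).@[fun t : 'I_#|coef_index| =>
     (G (enum_val t).1)@_(val (enum_val t).2)].

End Value.

(* The multivariate resultant of r forms of degree e in r variables, as the
   integer polynomial in the coefficients which is characterised by its
   vanishing locus, its value on powers of the variables and irreducibility. *)
Definition is_resultant (K : numFieldType) (Res : {mpoly int[#|coef_index|]})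
    : Prop :=
  [/\ forall G : 'I_r -> {mpoly K[r]}, (forall i, G i \is e.-homog) ->
        (resultant_value Res G = 0 <->
         exists2 x : 'rV[K]_r, x != 0 & forall i, (G i).@[x 0] = 0),
      resultant_value Res (fun i => 'X_i ^+ e : {mpoly K[r]}) = 1 &
      irreducible_mpoly (map_mpoly intr Res : {mpoly K[#|coef_index|]})].

End Resultant.

(* Homogenization to degree e; the homogenizing variable is the last one. *)
Definition homogenize (m : nat) (K : nzRingType) (e : nat) (g : {mpoly K[m]})
    : {mpoly K[m.+1]} :=
  \sum_(a <- msupp g) g@_a *:
    (\prod_(i < m) 'X_(lift ord_max i) ^+ a i * 'X_ord_max ^+ (e - mdeg a)).

(* Below m = k - 1, and the entries of a : 'rV_m.+1 are a_1, ..., a_k. *)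
Section NormalForm.
Variables (n m d : nat) (K : numFieldType) (a : 'rV[K]_m.+1).

Definition normal_form : {mpoly K[n]} :=
  \sum_(i < n) 'X_i ^+ d +
  (\sum_(i < n | (i <= m)%N) a 0 (inord i) *: 'X_i) ^+ d.

Definition system (j : 'I_m.+1) : {mpoly K[m]} :=
  if unlift ord_max j is Some i
  then a 0 ord_max *: 'X_i ^+ d.-1 - (a 0 j)%:MP
  else a 0 ord_max *: (\sum_(i < m) a 0 (lift ord_max i) *: 'X_i
                       + (a 0 ord_max)%:MP) ^+ d.-1 + 1.

Definition solution (u : 'rV[K]_m) : Prop := forall j, (system j).@[u 0] = 0.

Definition number_of_solutions (N : nat) : Prop :=
  exists2 s : seq 'rV[K]_m, uniq s /\ size s = N &
  forall u, u \in s <-> solution u.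

(* The point (u : 1 : 0 : ... : 0). *)
Definition point_of_solution (u : 'rV[K]_m) : 'rV[K]_n :=
  \row_(i < n) (if insub (i : nat) is Some j then u 0 j
                else if (i : nat) == m then 1 else 0).

End NormalForm.

Definition has_normal_form (n d : nat) (K : numFieldType) (f : {mpoly K[n]})
    (k : nat) (A : 'M[K]_n) (a : 'rV[K]_k.-1.+1) : Prop :=
  [/\ A \in unitmx, forall j, a 0 j != 0 &
      linear_subst A f = normal_form n d a].

(* Main.v *)
Require Import Defs.
From HB Require Import structures.
From mathcomp Require Import all_boot all_order all_algebra all_fingroup.
From mathcomp Require Import boolp reals complex mpoly ring.

(** Of the n + 1 linear forms of a minimal decomposition, n form a basis because
    f involves all the variables. In that basis f is the bordered Fermat form
    [sum x_i^d + L^d] with [L = sum b_i x_i], and k is the number of nonzero b_i,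
    listed first. If k were at most 1 the two powers of the same variable would
    merge, and if d were 2 the Gram matrix [1 + b^T b] would have a square root
    of the form [1 + c b^T b], so that n powers would suffice
    ([normal_form_exists], [waring_degree_ge3]). The number k is unique because
    it can be read off the center of f, the algebra of the endomorphisms that are
    self-adjoint for all the Hessians of f: from k = 3 on it consists of the
    diagonal matrices that are constant on the k variables of L, and for k = 2 it
    contains these matrices ([center_comparison]).

    The partial derivatives vanish at p exactly when [p_i^(d-1) = - b_i L(p)^(d-1)]
    for all i. This forces L(p) and the first k coordinates to be nonzero and the
    others to vanish, and after normalization it becomes the system (S). So the
    singular points are the solutions of (S), finitely many
    ([singular_pointP], [solutions_finite]); the homogenized system has no zero at
    infinity, so the vanishing of its resultant says that (S) is solvable
    ([resultant_system_zero]).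

    In the chart at a singular point the equation has the shape
    [sum_(j < k) psi_j v_j^2 + psi s^2 + sum w_j^d], where s is a linear form in
    the v_j and the psi are units. Replacing the v_j by their multiples by the
    square roots of the psi_j leaves a quadratic form with Gram matrix
    [1 + b^T b], where b now has entries in the local ring, and its square root
    [1 + c b^T b] gives the coordinates that turn the equation into a sum of
    squares and of d-th powers ([local_morse]). This needs inverses, square roots
    and the series c, that is, convergent roots of quadratic equations, provided
    by a Hensel lemma with majorants ([simple_root_lift]). Nondegeneracy holds
    because the Hessian determinant, computed with the critical equations, is a
    multiple of the last coefficient of L divided by L(p)
    ([hessian_nondegenerate]). The same computation identifies the Jacobian ideal
    with the ideal generated by the v_j and the w_j^(d-1), whose quotient has the
    standard monomials as a basis ([local_jacobian],
    [monomial_ideal_quotient_dim]); the equation belongs to this ideal, whence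
    the equality of the Milnor and Tjurina numbers.

    Finally, a nontrivial factorization would consist of homogeneous factors, and
    for n at least 4 their restrictions to three coordinates other than the first
    have a common zero, by elimination ([common_zero]). It would be a singular
    point with vanishing first coordinate, and there is none
    ([normal_form_irreducible]). *)

Set Implicit Arguments.
Unset Strict Implicit.
Unset Printing Implicit Defensive.

Import Order.TTheory GRing.Theory Num.Theory.
Local Open Scope ring_scope.

(** * Convergent power series: Hensel's lemma for quadratic equations *)

Section VanishingOrder.
Variables (m : nat) (K : comNzRingType).
Implicit Types f g : fps m K.

Definition vanishes_below (j : nat) f := forall a, (mdeg a < j)%N -> f a = 0.

Lemma vanishes_belowD j f g :
  vanishes_below j f -> vanishes_below j g -> vanishes_below j (f + g).
Proof. by move=> hf hg a ha; rewrite fps_coefD hf // hg // addr0. Qed.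

Lemma vanishes_belowW i j f :
  (i <= j)%N -> vanishes_below j f -> vanishes_below i f.
Proof. by move=> ij hf a ha; apply: hf; apply: leq_trans ij. Qed.

Lemma vanishes_belowM i j f g :
  vanishes_below i f -> vanishes_below j g -> vanishes_below (i + j) (f * g).
Proof.
move=> hf hg a ha.
change (fps_mul f g a = 0).
rewrite /fps_mul big1 // => k /eqP e.
have [h1|h1] := ltnP (mdeg k.1) i; first by rewrite hf ?mul0r.
rewrite [g _]hg ?mulr0 //.
rewrite -(ltn_add2l i); apply: leq_ltn_trans ha.
by rewrite [X in (_ <= mdeg X)%N]e mdegD leq_add2r.
Qed.

Lemma vanishes_below1 f : f 0%MM = 0 -> vanishes_below 1 f.
Proof. by move=> h a; rewrite ltnS leqn0 mdeg_eq0 => /eqP ->. Qed.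

Lemma fps_coef0M f g : (f * g) 0%MM = f 0%MM * g 0%MM.
Proof.
change (fps_mul f g 0%MM = f 0%MM * g 0%MM).
rewrite (@fps_mulE _ _ 1) ?mdeg0 // rmorphM /=.
by rewrite !fps_truncE mdeg0.
Qed.

End VanishingOrder.

Section Majorant.
Variables (m : nat) (K : numFieldType).
Implicit Types f g : fps m K.

(** The partial sums of the series of absolute values at [(r, ..., r)]; they are
    submultiplicative, which turns algebraic recursions into majorizations. *)
Definition majorant (r : K) b f : K :=
  \sum_(a : 'X_{1..m < b}) `|f a| * r ^+ mdeg a.

Lemma majorantD r b f g : 0 <= r ->
  majorant r b (f + g) <= majorant r b f + majorant r b g.
Proof.
move=> r0; rewrite /majorant -big_split /=; apply: ler_sum => a _.
rewrite -mulrDl; apply: ler_wpM2r; first by rewrite exprn_ge0.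
exact: ler_normD.
Qed.

Lemma majorant_ge0 r b f : 0 <= r -> 0 <= majorant r b f.
Proof. by move=> r0; apply: sumr_ge0 => a _; rewrite mulr_ge0 ?exprn_ge0. Qed.

Lemma majorantM r b f g : 0 <= r ->
  majorant r b (f * g) <= majorant r b f * majorant r b g.
Proof.
move=> r0.
pose F : fps m K := fun a => `|f a| * r ^+ mdeg a.
pose G : fps m K := fun a => `|g a| * r ^+ mdeg a.
have F0 a : 0 <= F a by rewrite mulr_ge0 // exprn_ge0.
have G0 a : 0 <= G a by rewrite mulr_ge0 // exprn_ge0.
have eval1 (H : fps m K) : (fps_trunc b H).@[fun=> 1] = \sum_(a : 'X_{1..m < b}) H a.
  rewrite /fps_trunc raddf_sum /=; apply: eq_bigr => a _.
  by rewrite mevalZ mevalX big1 ?mulr1 // => i _; rewrite expr1n.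
have -> : majorant r b f * majorant r b g
          = (fps_trunc b F * fps_trunc b G).@[fun=> 1] by rewrite mevalM !eval1.
apply: le_trans (mcoeff_sum_le b _); last first.
  move=> a; rewrite mcoeffM sumr_ge0 // => k _.
  by rewrite !fps_truncE mulr_ge0 //; case: ifP.
apply: ler_sum => a _; rewrite -(@fps_mulE m K b F G a) ?bmdeg //.
rewrite /fps_mul; under [X in _ <= X]eq_bigr => k /eqP e.
  rewrite /F /G mulrACA -exprD -mdegD -e -normrM; over.
rewrite -mulr_suml; apply: ler_wpM2r; first by rewrite exprn_ge0.
exact: ler_norm_sum.
Qed.

Lemma convergent_bounded f : convergent f -> exists r M : K,
  [/\ 0 < r, 0 <= M & forall s, 0 <= s <= r -> forall b, majorant s b f <= M].
Proof.
move=> /convergent_radius [r [M [r0 h]]]; exists r, M; split=> //.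
have h0 := h r _ 0; apply: le_trans (h0 _); last by rewrite lexx ltW.
by apply: (@majorant_ge0 r 0 f); apply: ltW.
Qed.

(** Shrinking the radius from [r] to [s] gains a factor [s / r] on every
    nonconstant term. *)
Lemma convergent_small f e : convergent f -> f 0%MM = 0 -> 0 < e ->
  exists2 r : K, 0 < r &
    forall s, 0 <= s <= r -> forall b, majorant s b f <= e.
Proof.
move=> /convergent_bounded[r [M [r0 M0 h]]] f0 e0.
have q0 : 0 < 1 + M / e by rewrite ltr_wpDr // divr_ge0 // ltW.
exists (r / (1 + M / e)); first by rewrite divr_gt0.
move=> s /andP[s0 sr] b.
have sr' : s / r <= (1 + M / e)^-1.
  by rewrite ler_pdivrMr // mulrC.
have lt1 : s / r <= 1.
  apply: le_trans sr' _; rewrite invf_le1 // lerDl divr_ge0 //; exact: ltW.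
have rr : 0 <= r <= r by rewrite lexx ltW.
apply: (@le_trans _ _ (s / r * majorant r b f)); last first.
  apply: (@le_trans _ _ (s / r * M)).
    by apply: ler_wpM2l; rewrite ?h // divr_ge0 // ltW.
  apply: (@le_trans _ _ ((1 + M / e)^-1 * M)); first exact: ler_wpM2r.
  rewrite mulrC ler_pdivrMr // mulrDr mulr1 mulrC divfK ?gt_eqF //.
  by rewrite lerDr ltW.
rewrite /majorant mulr_sumr; apply: ler_sum => a _.
have [->|a0] := eqVneq (bmnm a) 0%MM; first by rewrite f0 normr0 !mul0r mulr0.
rewrite mulrCA; apply: ler_wpM2l => //.
have -> : s ^+ mdeg a = (s / r) ^+ mdeg a * r ^+ mdeg a.
  by rewrite -exprMn divfK // gt_eqF.
apply: ler_wpM2r; first by rewrite exprn_ge0 // ltW.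
have : mdeg a != 0%N by rewrite mdeg_eq0.
case: (mdeg a) => // k _; rewrite exprS; apply: ler_piMr.
  by rewrite divr_ge0 // ltW.
by rewrite exprn_ile1 // divr_ge0 // ltW.
Qed.

Lemma pos_lower_bound (r s : K) : 0 < r -> 0 < s ->
  exists2 t : K, 0 < t & t <= r /\ t <= s.
Proof.
move=> r0 s0; have [rs|sr] := orP (real_leVge (gtr0_real r0) (gtr0_real s0)).
  by exists r.
by exists s.
Qed.

(** The equation [t = A + B t + C t^2] with [A] and [B] in the maximal ideal is
    solved by iteration from 0. The map on the right gains one order of
    contact at each step, so that the iterates stabilize coefficientwise, and on
    a small polydisc it maps a majorant ball into itself, so that the limit
    converges. *)
Section FixedPoint.
Variables A B C : fps m K.
Hypotheses (cA : convergent A) (cB : convergent B) (cC : convergent C).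
Hypotheses (A0 : A 0%MM = 0) (B0 : B 0%MM = 0).

Fixpoint quad_iter n : fps m K :=
  if n is n'.+1 then
    A + (B * quad_iter n' + C * (quad_iter n' * quad_iter n'))
  else 0.

Lemma quad_iter0 n : vanishes_below 1 (quad_iter n).
Proof.
elim: n => [|n IH] //=.
have vC : vanishes_below 0 C by [].
apply: vanishes_belowD; first exact: vanishes_below1.
apply: vanishes_belowD.
  by apply: (@vanishes_belowW _ _ _ (1 + 1)) => //; apply: vanishes_belowM => //; apply: vanishes_below1.
apply: (@vanishes_belowW _ _ _ (0 + (1 + 1))) => //.
by apply: vanishes_belowM => //; apply: vanishes_belowM.
Qed.

Lemma quad_step n f g : vanishes_below 1 f -> vanishes_below 1 g ->
  vanishes_below n (f - g) ->
  vanishes_below n.+1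
    ((A + (B * f + C * (f * f))) - (A + (B * g + C * (g * g)))).
Proof.
move=> hf hg h.
have -> : (A + (B * f + C * (f * f))) - (A + (B * g + C * (g * g)))
  = (B + C * (f + g)) * (f - g) by ring.
apply: (@vanishes_belowM _ _ 1 n) => //.
apply: vanishes_belowD; first exact: vanishes_below1.
apply: (@vanishes_belowM _ _ 0 1) => //.
exact: vanishes_belowD.
Qed.

Lemma quad_iter_cauchy n : vanishes_below n (quad_iter n.+1 - quad_iter n).
Proof.
elim: n => [|n IH] //.
exact: (quad_step (quad_iter0 n.+1) (quad_iter0 n) IH).
Qed.

Definition quad_lim : fps m K := fun a => quad_iter (mdeg a).+1 a.

Lemma quad_limE n a : (mdeg a < n)%N -> quad_iter n a = quad_lim a.
Proof.
elim: n => // n IH; rewrite ltnS leq_eqVlt => /orP[/eqP <- //|h].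
rewrite -IH //; apply/eqP; rewrite -subr_eq0.
have := quad_iter_cauchy h.
by rewrite fps_coefD fps_coefN => ->.
Qed.

Lemma quad_lim_fixed :
  quad_lim = A + (B * quad_lim + C * (quad_lim * quad_lim)).
Proof.
have near n : vanishes_below n (quad_lim - quad_iter n).
  by move=> a ha; rewrite fps_coefD fps_coefN quad_limE // subrr.
have l0 : vanishes_below 1 quad_lim.
  move=> a ha; rewrite -(@quad_limE 1) //; exact: quad_iter0.
apply/funext => a; apply/eqP; rewrite -subr_eq0.
set n := (mdeg a).+1.
have h1 := near n.+1 a (leqW (leqnn _)).
have h2 := quad_step l0 (quad_iter0 n) (near n) (leqW (leqnn _)).
move: h1 h2; rewrite !fps_coefD !fps_coefN /= => h1 h2.
by rewrite (subr0_eq h1) -(subr0_eq h2) subrr.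
Qed.

Lemma quad_lim_convergent : convergent quad_lim.
Proof.
have [rC [M [rC0 M0 hC]]] := convergent_bounded cC.
(* With rho = 1 / (4 (M + 1)), M a bound for C, and the majorants of A and B at
   most rho / 2 and 1 / 4, one step sends the majorant bound rho to
   rho / 2 + rho / 4 + M rho^2 <= rho. *)
pose rho : K := (4 * (M + 1))^-1.
have rho0 : 0 < rho by rewrite invr_gt0 mulr_gt0 // ltr_wpDl.
have [rA rA0 hA] := convergent_small cA A0 (divr_gt0 rho0 (ltr0Sn K 1)).
have [rB rB0 hB] := convergent_small cB B0 (divr_gt0 (@ltr01 K) (ltr0Sn K 3)).
have [r1 r10 [h1C h1A]] := pos_lower_bound rC0 rA0.
have [r r0 [h2 hrB]] := pos_lower_bound r10 rB0.
have rr := ltW r0.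
have hrC : 0 <= r <= rC by rewrite rr (le_trans h2).
have hrA : 0 <= r <= rA by rewrite rr (le_trans h2).
have {}hrB : 0 <= r <= rB by rewrite rr.
have bound n b : majorant r b (quad_iter n) <= rho.
  elim: n => [|n IH] /=.
    rewrite /majorant big1 ?ltW // => a _.
    have -> : `|(0 : fps m K) (bmnm a)| = 0 by exact: normr0.
    by rewrite mul0r.
  have t0 := majorant_ge0 b (quad_iter n) rr.
  apply: le_trans (majorantD _ _ _ rr) _.
  have -> : rho = rho / 2 + (1 / 4 * rho + M / (4 * (M+1)) * rho + (4 * (M + 1))^-1 * rho).
    have : M + 1 != 0 by rewrite gt_eqF // ltr_wpDl.
    by move=> ?; rewrite /rho; field.
  apply: lerD; first exact: hA.
  apply: (@le_trans _ _ (1 / 4 * rho + M / (4 * (M + 1)) * rho)); last first.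
    by rewrite lerDl mulr_ge0 // ltW.
  apply: le_trans (majorantD _ _ _ rr) _; apply: lerD.
    apply: le_trans (majorantM _ _ _ rr) _.
    by apply: ler_pM => //; [exact: majorant_ge0 | exact: hB].
  apply: le_trans (majorantM _ _ _ rr) _.
  rewrite -mulrA; apply: ler_pM; [exact: majorant_ge0|exact: majorant_ge0|exact: hC|].
  apply: le_trans (majorantM _ _ _ rr) _.
  by apply: ler_pM.
exists r, rho; split=> // b; apply: le_trans (bound b b).
by apply: ler_sum => a _; rewrite quad_limE // bmdeg.
Qed.

Lemma quad_lim0 : quad_lim 0%MM = 0.
Proof. by rewrite -(@quad_limE 1) ?mdeg0 //; apply: quad_iter0; rewrite mdeg0. Qed.

End FixedPoint.
End Majorant.

Section ConvergentRing.
Variables (m : nat) (K : numFieldType).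
Implicit Types f g : cps m K.

Definition const_term f : K := cps_val f 0%MM.

Fact const_term_is_zmod_morphism : zmod_morphism const_term.
Proof. by []. Qed.
Fact const_term_is_monoid_morphism : monoid_morphism const_term.
Proof.
split; last by move=> f g; apply: fps_coef0M.
change ((1 : {mpoly K[m]})@_0 = 1).
by rewrite mcoeff1 eqxx.
Qed.
HB.instance Definition _ := GRing.isZmodMorphism.Build _ _ _ const_term_is_zmod_morphism.
HB.instance Definition _ := GRing.isMonoidMorphism.Build _ _ _ const_term_is_monoid_morphism.

End ConvergentRing.

Arguments const_term : simpl never.

Section Hensel.
Variables (m : nat) (K : numFieldType).
Implicit Types f g : cps m K.

Definition cconst (c : K) : cps m K := cps_of_mpoly c%:MP.

Lemma cps_of_mpoly_is_zmod_morphism : zmod_morphism (@cps_of_mpoly m K).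
Proof.
move=> p q; apply: val_inj; apply/funext => a /=.
by rewrite /fps_of_mpoly mcoeffB.
Qed.
Lemma cps_of_mpoly_is_monoid_morphism : monoid_morphism (@cps_of_mpoly m K).
Proof.
split; first exact: val_inj.
move=> p q; apply: val_inj; apply/funext => a /=.
change ((p * q)@_a = fps_mul (fps_of_mpoly p) (fps_of_mpoly q) a).
rewrite (@fps_mulE _ _ (mdeg a).+1) //.
apply: (@mcoeffM_eq _ _ _ _ _ _ (mdeg a).+1) => // b hb;
  by rewrite fps_truncE hb.
Qed.
HB.instance Definition _ := GRing.isZmodMorphism.Build _ _ _ cps_of_mpoly_is_zmod_morphism.
HB.instance Definition _ := GRing.isMonoidMorphism.Build _ _ _ cps_of_mpoly_is_monoid_morphism.

Lemma const_term_mpoly (p : {mpoly K[m]}) : const_term (cps_of_mpoly p) = p@_0%MM.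
Proof. by []. Qed.

Lemma const_term_cconst c : const_term (cconst c) = c.
Proof. by rewrite const_term_mpoly mcoeffC eqxx mulr1. Qed.

Lemma quadratic_fixed_point (A B C : cps m K) :
  const_term A = 0 -> const_term B = 0 ->
  exists2 t, const_term t = 0 & t = A + B * t + C * t ^+ 2.
Proof.
move=> A0 B0.
have cv (f : cps m K) : convergent f by case: f => f /= /asboolP.
have cT := quad_lim_convergent (cv A) (cv B) (cv C) A0 B0.
exists (Cps (introT (asboolP _) cT)); first exact: quad_lim0.
apply: val_inj; rewrite /= {1}quad_lim_fixed //.
by rewrite -addrA.
Qed.

(** Hensel's lemma. Writing a root as [x0 + t] and dividing by the derivative [l]
    at [x0], which is nonzero, leaves a fixed point equation for [t]. Inverses,
    square roots and the change of coordinates in the Morse lemma are all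
    instances. *)
Lemma simple_root_lift (al be ga : cps m K) (x0 : K) :
  const_term al * x0 ^+ 2 + const_term be * x0 + const_term ga = 0 ->
  2 * const_term al * x0 + const_term be != 0 ->
  exists2 x, const_term x = x0 & al * x ^+ 2 + be * x + ga = 0.
Proof.
move=> r0; set l := (X in X != 0) => l0.
pose X0 := cconst x0; pose li := cconst l^-1.
pose p0 := al * X0 ^+ 2 + be * X0 + ga.
pose p1 := 2 * al * X0 + be - cconst l.
have [||t t0 tE] := @quadratic_fixed_point (- li * p0) (- li * p1) (- li * al).
- by rewrite /p0 /X0 /li !(rmorph_nat, rmorphM, rmorphN, rmorphD, rmorphXn) /= !const_term_cconst r0 mulr0.
- rewrite /p1 /X0 /li !(rmorph_nat, rmorphM, rmorphN, rmorphD, rmorphXn) /= !const_term_cconst.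
  by rewrite subrr mulr0.
exists (X0 + t); first by rewrite rmorphD /X0 /= t0 const_term_cconst addr0.
have lK : cconst l * li = 1.
  by rewrite /cconst -rmorphM /= -mpolyCM divff // rmorph1.
have : cconst l * t = - (p0 + p1 * t + al * t ^+ 2).
  rewrite {1}tE; transitivity (- (cconst l * li) * (p0 + p1 * t + al * t ^+ 2)).
    by ring.
  by rewrite lK mulN1r.
move=> e; apply/eqP; rewrite -(subrr (cconst l * t)) {2}e; apply/eqP.
rewrite /p0 /p1; ring.
Qed.

Lemma cps_inverse f : const_term f != 0 -> exists g, f * g = 1.
Proof.
move=> f0; have [||g _ h] := @simple_root_lift 0 f (-1) (const_term f)^-1.
- by rewrite rmorph0 mul0r add0r divff // rmorphN rmorph1 subrr.
- by rewrite rmorph0 mulr0 mul0r add0r.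
by exists g; apply/eqP; move: h => /eqP; rewrite mul0r add0r subr_eq0.
Qed.

End Hensel.

Lemma cps_sqrt m (K : numClosedFieldType) (f : cps m K) : const_term f != 0 ->
  exists2 g, const_term g != 0 & g ^+ 2 = f.
Proof.
move=> f0; pose x0 := sqrtC (const_term f).
have x00 : x0 != 0 by rewrite sqrtC_eq0.
have [||g gx h] := @simple_root_lift m K 1 0 (- f) x0.
- by rewrite rmorph1 rmorph0 mul0r mul1r addr0 rmorphN sqrtCK subrr.
- by rewrite rmorph1 rmorph0 addr0 mulr1 mulf_neq0 // pnatr_eq0.
exists g; first by rewrite gx.
by apply/eqP; move: h => /eqP; rewrite mul1r mul0r addr0 subr_eq0.
Qed.

(** * The ideal generated by powers of the variables *)

Section MonomialIdeal.
Variables (m : nat) (K : numFieldType) (E : 'I_m -> nat).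
Implicit Types f g : cps m K.

Definition cX (j : 'I_m) : cps m K := cps_of_mpoly 'X_j.

Lemma coef_mul_monomial f (u a : 'X_{1..m}) :
  cps_val (f * cps_of_mpoly 'X_[u]) a =
  if (u <= a)%MM then cps_val f (a - u)%MM else 0.
Proof.
change (fps_mul (cps_val f) (fps_of_mpoly 'X_[u]) a =
  if (u <= a)%MM then cps_val f (a - u)%MM else 0).
case: ifP => [ua|/negP ua].
  rewrite (@fps_mulE _ _ (mdeg a).+1) //.
  rewrite (@mcoeffM_eq _ _ _ _ (fps_trunc (mdeg a).+1 (cps_val f)) 'X_[u] (mdeg a).+1) //.
    have {1}-> : a = (u + (a - u))%MM by rewrite addmC submK.
    by rewrite mcoeffMX fps_truncE -{2}(submK ua) mdegD ltnS leq_addr.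
  by move=> b hb; rewrite fps_truncE hb.
rewrite /fps_mul big1 // => k /eqP e.
rewrite /fps_of_mpoly mcoeffX; case: eqP => [ek|]; last by rewrite mulr0.
case: ua; apply/mnm_lepP => i.
by have /mnmP/(_ i) -> := e; rewrite ek mnmDE leq_addl.
Qed.

Lemma cXE j e : cX j ^+ e = cps_of_mpoly 'X_[U_(j) *+ e].
Proof. by rewrite /cX -rmorphXn /= mpolyXn. Qed.

Lemma scaled_unit_le (a : 'X_{1..m}) j e : (U_(j) *+ e <= a)%MM = (e <= a j)%N.
Proof.
apply/mnm_lepP/idP => [/(_ j)|h i].
  by rewrite mulmnE mnm1E eqxx mul1n.
by rewrite mulmnE mnm1E; case: eqP => [<-|_]; rewrite ?mul1n ?mul0n.
Qed.

Lemma convergent_shift (f : fps m K) (P : pred 'X_{1..m}) (u : 'X_{1..m}) :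
  convergent f -> convergent (fun a => if P a then f (a + u)%MM else 0).
Proof.
move=> [r [M [r0 h]]]; exists r, (M / r ^+ mdeg u); split=> // b.
rewrite ler_pdivlMr ?exprn_gt0 //; apply: le_trans (h (b + mdeg u)%N).
have shP (a : 'X_{1..m < b}) : (mdeg (a + u)%MM < b + mdeg u)%N.
  by rewrite mdegD ltn_add2r bmdeg.
pose sh (a : 'X_{1..m < b}) : 'X_{1..m < b + mdeg u} := BMultinom (shP a).
have shE a : (sh a : 'X_{1..m}) = (a + u)%MM by [].
have sh_inj : injective sh.
  move=> a a' /(congr1 (fun x => bmnm x)); rewrite !shE => e.
  by apply/val_inj; apply: (addIm e).
rewrite (bigID (mem (sh @: setT))) /= big_imset /=; last by move=> ? ? _ _; apply: sh_inj.
rewrite -[leLHS]addr0; apply: lerD; last first.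
  by apply: sumr_ge0 => a _; rewrite mulr_ge0 ?exprn_ge0 // ltW.
rewrite mulr_suml; rewrite [leRHS](eq_bigl xpredT) //; last by move=> a; rewrite inE.
apply: ler_sum => a _ /=; rewrite mdegD exprD mulrA.
rewrite !ler_wpM2r ?exprn_ge0 ?(ltW r0) //.
by case: ifP => // _; rewrite normr0.
Qed.

Definition standard (a : 'X_{1..m}) := [forall j, (a j < E j)%N].

Lemma monomial_ideal_vanish (c : 'I_m -> cps m K) a : standard a ->
  cps_val (\sum_j c j * cX j ^+ E j) a = 0.
Proof.
move=> /forallP sa.
have valD f g : cps_val (f + g) a = cps_val f a + cps_val g a by [].
rewrite (big_morph (fun f : cps m K => cps_val f a) valD (erefl : cps_val 0 a = 0)).
rewrite big1 // => j _.
by rewrite cXE coef_mul_monomial scaled_unit_le leqNgt sa.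
Qed.

(** For the converse, the part of [g] made of the monomials [a] whose first index
    [j] with [E j <= a j] is given is divisible by [X_j^(E j)], and the quotient
    is a shift of a part of [g], hence converges. *)
Lemma monomial_ideal_memP g :
  (exists c : 'I_m -> cps m K, g = \sum_j c j * cX j ^+ E j) <->
  (forall a, standard a -> cps_val g a = 0).
Proof.
split=> [[c ->] a|h]; first exact: monomial_ideal_vanish.
pose first (j : 'I_m) (a : 'X_{1..m}) := [forall i : 'I_m, (i < j)%N ==> (a i < E i)%N].
have cg : convergent g by case: g {h} => g /= /asboolP.
pose c j : cps m K := Cps (introT (asboolP _)
  (convergent_shift (first j) (U_(j) *+ E j)%MM cg)).
exists c; apply: val_inj; apply/funext => a /=.
have valD f g' : cps_val (f + g') a = cps_val f a + cps_val g' a by [].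
rewrite (big_morph (fun f : cps m K => cps_val f a) valD (erefl : cps_val 0 a = 0)).
have coefE j : cps_val (c j * cX j ^+ E j) a =
    if (E j <= a j)%N && first j a then cps_val g a else 0.
  rewrite cXE coef_mul_monomial scaled_unit_le; case: leqP => //= ha.
  have le : (U_(j) *+ E j <= a)%MM by rewrite scaled_unit_le.
  rewrite submK //; congr (if _ then _ else _); apply: eq_forallb => i.
  case: ltnP => //= ij; rewrite mnmBE mulmnE mnm1E.
  have /negbTE -> : j != i by rewrite neq_ltn ij orbT.
  by rewrite mul0n subn0.
under eq_bigr do rewrite coefE.
have [sa|] := boolP (standard a).
  rewrite h // big1 // => j _; by case: ifP.
rewrite negb_forall => /existsP[j0 hj0].
case: (arg_minnP (P := fun j : 'I_m => (E j <= a j)%N) (@nat_of_ord m) (i0 := j0)).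
  by rewrite leqNgt.
move=> j1 hj1 minj.
have fj1 : first j1 a.
  apply/forallP => i; apply/implyP => ij; rewrite ltnNge; apply/negP => /minj.
  by rewrite leqNgt ij.
rewrite (bigD1 j1) //= hj1 fj1 big1 ?addr0 // => j jj1.
case: ifP => // /andP[hj /forallP fj].
have := minj j hj; rewrite leq_eqVlt => /orP[/eqP/val_inj e|lt].
  by rewrite e eqxx in jj1.
by have := fj j1; rewrite lt /= ltnNge hj1.
Qed.

(** The standard monomials form a basis: the coordinates of [g] are its
    coefficients at these monomials. *)
Lemma monomial_ideal_quotient_dim (gens : seq (cps m K)) :
  (forall g, in_ideal gens g <->
     exists c : 'I_m -> cps m K, g = \sum_j c j * cX j ^+ E j) ->
  quotient_dim gens (\prod_j E j)%N.
Proof.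
move=> gensE.
pose T := {dffun forall j : 'I_m, 'I_(E j)}.
have cT : #|T| = (\prod_j E j)%N.
  rewrite card_dep_ffun foldrE big_map big_enum /=.
  by apply: eq_bigr => j _; rewrite card_ord.
rewrite -cT.
pose mon (i : 'I_#|T|) : 'X_{1..m} := [multinom (enum_val i j : nat) | j < m].
have mon_std i : standard (mon i) by apply/forallP => j; rewrite mnmE.
have mon_inj : injective mon.
  move=> i i' /mnmP e; apply: enum_val_inj; apply/ffunP => j.
  by have := e j; rewrite !mnmE => /val_inj.
have mon_onto a : standard a -> exists i, mon i = a.
  move=> /forallP sa; pose t : T := [ffun j => Ordinal (sa j)].
  by exists (enum_rank t); apply/mnmP => j; rewrite mnmE enum_rankK ffunE.
pose comb (c : 'rV[K]_#|T|) : cps m K :=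
  \sum_(i < #|T|) cps_of_mpoly (c 0 i)%:MP * cps_of_mpoly 'X_[mon i].
have comb_mon c i : cps_val (comb c) (mon i) = c 0 i.
  have -> : comb c = cps_of_mpoly (\sum_(i < #|T|) c 0 i *: 'X_[mon i]).
    by rewrite rmorph_sum; apply: eq_bigr => k _; rewrite -rmorphM /= mul_mpolyC.
  change ((\sum_(i < #|T|) c 0 i *: 'X_[mon i])@_(mon i) = c 0 i).
  rewrite raddf_sum (bigD1 i) //= big1 ?addr0.
    by rewrite mcoeffZ mcoeffX eqxx mulr1.
  move=> k ki; rewrite mcoeffZ mcoeffX (inj_eq mon_inj) (negbTE ki).
  by rewrite mulr0.
exists (fun i => cps_of_mpoly 'X_[mon i]) => g.
exists (\row_i cps_val g (mon i)); split.
  apply/gensE/monomial_ideal_memP => a /mon_onto[i <-].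
  change (cps_val g (mon i) - cps_val (comb (\row_i cps_val g (mon i))) (mon i) = 0).
  by rewrite comb_mon mxE subrr.
move=> c /gensE/monomial_ideal_memP h; apply/rowP => i; rewrite mxE.
apply/eqP; rewrite -subr_eq0; apply/eqP; rewrite -(comb_mon c i).
exact: h (mon_std i).
Qed.

End MonomialIdeal.

(** * Ideals and Taylor expansions in the local ring *)

Section Ideals.
Variables (m : nat) (K : numFieldType).
Implicit Types (f g : cps m K) (gens : seq (cps m K)).

Lemma in_ideal0 gens : in_ideal gens 0.
Proof. by exists (fun=> 0); rewrite big1 // => i _; rewrite mul0r. Qed.

Lemma in_idealD gens f g : in_ideal gens f -> in_ideal gens g -> in_ideal gens (f + g).
Proof.
move=> [c ->] [c' ->]; exists (fun i => c i + c' i).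
by rewrite -big_split; apply: eq_bigr => i _; rewrite mulrDl.
Qed.

Lemma in_idealMl gens f g : in_ideal gens g -> in_ideal gens (f * g).
Proof.
move=> [c ->]; exists (fun i => f * c i).
by rewrite mulr_sumr; apply: eq_bigr => i _; rewrite mulrA.
Qed.

Lemma in_ideal_sum gens (I : Type) (r : seq I) (P : pred I) (F : I -> cps m K) :
  (forall i, P i -> in_ideal gens (F i)) -> in_ideal gens (\sum_(i <- r | P i) F i).
Proof.
move=> h; elim/big_rec: _ => [|i g Pi hg]; first exact: in_ideal0.
exact: in_idealD (h i Pi) hg.
Qed.

Lemma in_ideal_mem gens g : g \in gens -> in_ideal gens g.
Proof.
move=> /(nthP 0)[i isz <-]; exists (fun j => (j == i :> nat)%:R).
rewrite (bigD1 (Ordinal isz)) //= eqxx mul1r big1 ?addr0 // => j ji.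
have : (j : nat) != i by apply: contra ji => /eqP e; apply/eqP/val_inj.
by move=> /negbTE ->; rewrite mul0r.
Qed.

Lemma in_ideal_trans gens gens' g :
  (forall f, f \in gens -> in_ideal gens' f) -> in_ideal gens g -> in_ideal gens' g.
Proof.
move=> h [c ->]; apply: in_ideal_sum => i _; apply: in_idealMl; apply: h.
exact: mem_nth.
Qed.

Lemma in_ideal_family n (G : 'I_n -> cps m K) g :
  in_ideal [seq G j | j <- enum 'I_n] g <->
  exists c : 'I_n -> cps m K, g = \sum_j c j * G j.
Proof.
split=> [|[c ->]]; last first.
  apply: in_ideal_sum => j _; apply: in_idealMl; apply: in_ideal_mem.
  by rewrite map_f // mem_enum.
set s := map _ _.
have sz : size s = n by rewrite size_map size_enum_ord.
move=> [c ->]; exists (fun j => c (cast_ord (esym sz) j)).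
rewrite (reindex (cast_ord (esym sz))) /=; last first.
  by exists (cast_ord sz) => j _; rewrite ?cast_ordK ?cast_ordKV.
apply: eq_bigr => j _; congr (_ * _).
by rewrite (nth_map j) ?size_enum_ord //= nth_ord_enum.
Qed.

End Ideals.

Section Taylor.
Variables (m : nat) (K : numFieldType).
Implicit Types x : cps m K.

Fact cconst_is_zmod_morphism : zmod_morphism (@cconst m K).
Proof. by move=> c c'; rewrite /cconst mpolyCB rmorphB. Qed.
Fact cconst_is_monoid_morphism : monoid_morphism (@cconst m K).
Proof. by split=> [|c c']; rewrite /cconst ?mpolyCM ?rmorphM // mpolyC1 rmorph1. Qed.
HB.instance Definition _ := GRing.isZmodMorphism.Build _ _ _ cconst_is_zmod_morphism.
HB.instance Definition _ := GRing.isMonoidMorphism.Build _ _ _ cconst_is_monoid_morphism.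

Lemma cconstD c c' : cconst m (c + c') = cconst m c + cconst m c' :> cps m K.
Proof. exact: rmorphD. Qed.
Lemma cconstM c c' : cconst m (c * c') = cconst m c * cconst m c' :> cps m K.
Proof. exact: rmorphM. Qed.
Lemma cconst_sum I (r : seq I) (P : pred I) (F : I -> K) :
  cconst m (\sum_(i <- r | P i) F i) = \sum_(i <- r | P i) cconst m (F i) :> cps m K.
Proof. exact: rmorph_sum. Qed.

(** The binomial theorem up to order 2; only the constant term of the remainder
    matters, since it decides whether the remainder is a unit. *)
Lemma taylor2 d z x : const_term x = 0 ->
  exists2 psi, const_term psi = 'C(d, 2)%:R * z ^+ (d - 2)%N &
  (cconst m z + x) ^+ d = cconst m (z ^+ d) + cconst m (d%:R * z ^+ d.-1) * x + x ^+ 2 * psi.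
Proof.
move=> x0; elim: d => [|d [psi psi0 IH]].
  exists 0; first by rewrite rmorph0 mul0r.
  by rewrite mul0r !rmorph0 mul0r mulr0 !addr0 rmorph1.
exists ((cconst m z + x) * psi + cconst m (d%:R * z ^+ d.-1)).
  rewrite rmorphD rmorphM rmorphD /= !const_term_cconst x0 addr0 psi0.
  rewrite binS bin1 natrD mulrDl.
  case: d {IH psi0} => [|[|d]].
  - by rewrite (@bin_small 0 2) // !mul0r mulr0.
  - by rewrite (@bin_small 1 2) // !mul0r mulr0.
  by rewrite mulrCA -exprS -subSn // subSS subn1.
rewrite exprS IH !rmorphM /= !rmorph_nat !rmorphXn /=.
case: d {IH psi0} => [|d]; first by rewrite !expr0; ring.
rewrite /= !exprS -[d.+2%:R]natr1; ring.
Qed.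

Lemma taylor1 e z x : const_term x = 0 ->
  exists2 theta, const_term theta = e%:R * z ^+ e.-1 &
  (cconst m z + x) ^+ e = cconst m (z ^+ e) + x * theta.
Proof.
move=> x0; have [psi psi0 ->] := taylor2 e z x0.
exists (cconst m (e%:R * z ^+ e.-1) + x * psi); last by ring.
by rewrite rmorphD rmorphM /= x0 const_term_cconst mul0r addr0.
Qed.

Definition linear_coef (j : 'I_m) (f : cps m K) : K := cps_val f U_(j)%MM.

Lemma linear_coefD j f g : linear_coef j (f + g) = linear_coef j f + linear_coef j g.
Proof. by []. Qed.

Lemma linear_coef_sum j I r (P : pred I) (F : I -> cps m K) :
  linear_coef j (\sum_(i <- r | P i) F i) = \sum_(i <- r | P i) linear_coef j (F i).
Proof. exact: (big_morph (linear_coef j) (linear_coefD j)). Qed.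

(** The linear coefficient is the derivative at 0. *)
Lemma linear_coefM j f g :
  linear_coef j (f * g) = const_term f * linear_coef j g + linear_coef j f * const_term g.
Proof.
pose T (h : cps m K) := fps_trunc 2 (cps_val h).
have TE h a : (mdeg a < 2)%N -> (T h)@_a = cps_val h a.
  by move=> ha; rewrite fps_truncE ha.
have -> : linear_coef j (f * g) = (T f * T g)@_U_(j).
  change (fps_mul (cps_val f) (cps_val g) U_(j)%MM = (T f * T g)@_U_(j)).
  by rewrite (@fps_mulE _ _ 2) // mdeg1.
have der (p : {mpoly K[m]}) : p@_U_(j) = (p^`M(j))@_0%MM.
  by rewrite mcoeff_deriv mnm0E mulr1n add0m.
rewrite der mderivM mcoeffD !rmorphM /= -!der.
by rewrite !TE ?mdeg1 ?mdeg0 // addrC.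
Qed.

End Taylor.

Arguments linear_coef : simpl never.

(** * The local equation at a singular point *)

Lemma rank_one_unit N (K : fieldType) (b : 'rV[K]_N) (c : K) :
  1 + c * (\sum_j b 0 j ^+ 2) != 0 -> 1%:M + c *: (b^T *m b) \in unitmx.
Proof.
set s := \sum_j _ => h; have bb : b *m b^T = s%:M.
  by rewrite [LHS]mx11_scalar mxE; congr (_%:M); apply: eq_bigr => j _; rewrite mxE.
pose t := c / (1 + c * s).
suff /mulmx1_unit[] : (1%:M + c *: (b^T *m b)) *m (1%:M - t *: (b^T *m b)) = 1%:M by [].
rewrite mulmxDl mul1mx mulmxBr mulmx1 -!scalemxAl -!scalemxAr.
rewrite mulmxA -(mulmxA b^T) bb mul_mx_scalar -scalemxAl.
rewrite !scalerA -[in RHS](addr0 1%:M) -addrA; congr (_ + _).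
rewrite -scaleNr -scalerBl -scalerDl; rewrite -[RHS](scale0r (b^T *m b)).
by congr (_ *: _); rewrite /t; field.
Qed.

(** The solutions [c] are those for which [1 + c b^T b] is a square root of
    [1 + b^T b], where [s = b b^T]. *)
Lemma rank_one_square_root (K : numClosedFieldType) (s : K) :
  exists c, s * c ^+ 2 + 2 * c - 1 = 0.
Proof.
have [->|s0] := eqVneq s 0.
  by exists 2^-1; rewrite mul0r add0r divff ?subrr // pnatr_eq0.
exists ((sqrtC (1 + s) - 1) / s).
have := sqrtCK (1 + s); set r := sqrtC _ => rE.
have -> : s = r ^+ 2 - 1 by rewrite rE; ring.
field; by rewrite rE addrC addKr.
Qed.

Lemma const_term_cX N (K : numFieldType) j : const_term (@cX N K j) = 0.
Proof.
rewrite const_term_mpoly mcoeffX; case: eqP => // /(congr1 (fun a : 'X_{1..N} => a j)).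
by rewrite mnm1E eqxx mnm0E.
Qed.

Section Derivatives.
Variables (n : nat) (R : comNzRingType).

Lemma mderiv_exp (j : 'I_n) (p : {mpoly R[n]}) k :
  (p ^+ k.+1)^`M(j) = k.+1%:R *: (p ^+ k * p^`M(j)).
Proof.
elim: k => [|k IH]; first by rewrite expr1 expr0 mul1r scale1r.
rewrite exprS mderivM IH -[k.+2%:R]nat1r scalerDl scale1r mulrC; congr (_ + _).
by rewrite -scalerAr [_ ^+ k.+1]exprS mulrA.
Qed.

Lemma mderiv_var (i j : 'I_n) : ('X_i : {mpoly R[n]})^`M(j) = (i == j)%:R.
Proof.
rewrite mderivX mnm1E; case: eqP => [->|_]; last by rewrite scale0r.
have -> : (U_(j) - U_(j))%MM = 0%MM.
  by apply/mnmP => i'; rewrite mnmBE mnm0E subnn.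
by rewrite mpolyX0 scale1r.
Qed.

End Derivatives.

Section RankOneMorse.
Variables (N : nat) (K : numClosedFieldType) (b Y : 'I_N -> cps N K) (d : 'I_N -> K).
Hypothesis d_neq0 : forall i, d i != 0.
Hypothesis Y_const : forall i, const_term (Y i) = 0.
Hypothesis Y_linear : forall i j, linear_coef j (Y i) = d i * (i == j)%:R.

Let sigma := \sum_j b j ^+ 2.
Let w := \sum_j b j * Y j.

(** The Gram matrix [1 + b^T b] of [sum Y_j ^ 2 + w ^ 2] is the square of
    [1 + c b^T b] as soon as [sigma c ^ 2 + 2 c = 1], a quadratic equation that
    Hensel's lemma solves in the local ring; so the linear change of
    coordinates [1 + c b^T b] turns the form into a sum of squares, without any
    pivoting. *)
Lemma rank_one_morse : 1 + const_term sigma != 0 ->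
  exists c : cps N K, let y j := Y j + c * b j * w in
    analytic_coordinates y /\ \sum_j y j ^+ 2 = \sum_j Y j ^+ 2 + w ^+ 2.
Proof.
move=> sigma1.
pose b0 : 'rV[K]_N := \row_j const_term (b j).
have sigma0E : const_term sigma = \sum_j b0 0 j ^+ 2.
  by rewrite rmorph_sum; apply: eq_bigr => j _; rewrite mxE rmorphXn.
have w0 : const_term w = 0.
  by rewrite rmorph_sum big1 // => j _; rewrite rmorphM /= Y_const mulr0.
have [c0 c0E] := rank_one_square_root (const_term sigma).
(* (1 + c0 sigma)^2 = 1 + sigma, hence c0 is a simple root and the Jacobian
   matrix below is invertible. *)
have c0_simple : 1 + c0 * const_term sigma != 0.
  apply: contra_neq sigma1 => c1.
  have <- : (1 + c0 * const_term sigma) ^+ 2 = 1 + const_term sigma.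
    apply/eqP; rewrite -subr_eq0 -[X in _ == X](mulr0 (const_term sigma)) -c0E.
    by apply/eqP; ring.
  by rewrite c1 expr0n.
have [||c cE c_root] := @simple_root_lift N K sigma 2 (-1) c0.
- by rewrite rmorphN rmorph1 rmorph_nat.
- rewrite rmorph_nat.
  have -> : 2 * const_term sigma * c0 + 2 = 2 * (1 + c0 * const_term sigma) by ring.
  by rewrite mulf_neq0 // pnatr_eq0.
exists c => y; split; last first.
  transitivity (\sum_j (Y j ^+ 2 + 2 * c * w * (b j * Y j) + (c * w) ^+ 2 * b j ^+ 2)).
    by apply: eq_bigr => j _; rewrite /y; ring.
  rewrite !big_split /= -!mulr_sumr -/w -/sigma -addrA; congr (_ + _).
  rewrite -[RHS]addr0 -[X in _ = _ + X](mulr0 (w ^+ 2)) -c_root; ring.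
split.
  move=> j; change (const_term (y j) = 0).
  by rewrite rmorphD !rmorphM /= Y_const w0 !mulr0 addr0.
set J := \matrix_(i, j) _.
pose D : 'M[K]_N := diag_mx (\row_j d j).
have w_linear j : linear_coef j w = b0 0 j * d j.
  rewrite linear_coef_sum (bigD1 j) //= big1 => [|i ij].
    by rewrite linear_coefM Y_linear Y_const eqxx mulr1 mulr0 !addr0 mxE.
  by rewrite linear_coefM Y_linear Y_const (negbTE ij) !mulr0 addr0.
have -> : J = (1%:M + c0 *: (b0^T *m b0)) *m D.
  apply/matrixP => i j; rewrite mul_mx_diag !mxE.
  change (linear_coef j (y i) =
    ((i == j)%:R + c0 * \sum_k b0^T i k * b0 k j) * d j).
  rewrite big_ord1 linear_coefD Y_linear linear_coefM w_linear w0 mulr0 addr0.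
  rewrite rmorphM /= cE !mxE mulrDl; congr (_ + _); last by rewrite !mulrA.
  by case: eqP => [->|]; rewrite ?mulr1 ?mul1r // mulr0 mul0r.
rewrite unitmx_mul rank_one_unit -?sigma0E //=.
by rewrite unitmxE det_diag unitfE; apply/prodf_neq0 => j _; rewrite mxE.
Qed.

End RankOneMorse.

(** In the chart where the last nonzero coordinate of a singular point is 1, the
    normal form reads [1 + sum (z_j + X_j)^(e+1) + (lambda + sum beta_j X_j)^(e+1)],
    where [z] is the point and [lambda] the value there of the extra linear
    form, whose coefficients are [beta] and, on the dehomogenized coordinate,
    [beta_k]. The hypotheses [critical] and [critical_k] are the vanishing of
    the partial derivatives. *)
Section LocalNormalForm.
Variables (N q e : nat) (K : numClosedFieldType).
Variables (z beta : 'I_N -> K) (beta_k lambda : K).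
Hypotheses (e_gt1 : (1 < e)%N) (beta_k_neq0 : beta_k != 0) (lambda_neq0 : lambda != 0).
Hypothesis below : forall j : 'I_N, (j < q)%N -> beta j != 0 /\ z j != 0.
Hypothesis above : forall j : 'I_N, (q <= j)%N -> beta j = 0 /\ z j = 0.
Hypothesis lambdaE : lambda = beta_k + \sum_j beta j * z j.
Hypothesis critical : forall j, z j ^+ e = - beta j * lambda ^+ e.
Hypothesis critical_k : 1 = - beta_k * lambda ^+ e.

Local Notation cc := (@cconst N K).
Local Notation x := (@cX N K).

Definition local_poly : {mpoly K[N]} :=
  1 + \sum_j ((z j)%:MP + 'X_j) ^+ e.+1
  + (beta_k%:MP + \sum_j beta j *: ((z j)%:MP + 'X_j)) ^+ e.+1.

Let s : cps N K := \sum_j cc (beta j) * x j.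

Let s0 : const_term s = 0.
Proof.
by rewrite rmorph_sum big1 // => j _; rewrite rmorphM /= const_term_cX mulr0.
Qed.

Let e_neq0 : e%:R != 0 :> K. Proof. by rewrite pnatr_eq0 -lt0n ltnW. Qed.

Let e1_neq0 : e.+1%:R != 0 :> K. Proof. by rewrite pnatr_eq0. Qed.

Let bin_neq0 : 'C(e.+1, 2)%:R != 0 :> K.
Proof. by rewrite pnatr_eq0 -lt0n bin_gt0 ltnW. Qed.

Let z_pow_neq0 (j : 'I_N) : (j < q)%N -> z j ^+ e.-1 != 0.
Proof. by move=> /below[_ zj]; rewrite expf_neq0. Qed.

Let lambda_pow_neq0 : lambda ^+ e.-1 != 0. Proof. by rewrite expf_neq0. Qed.

Let sum_below (V : zmodType) (G : 'I_N -> V) :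
  (forall j : 'I_N, (q <= j)%N -> G j = 0) -> \sum_j G j = \sum_(j < N | (j < q)%N) G j.
Proof.
move=> G0; rewrite (bigID (fun j : 'I_N => (j < q)%N)) /= [X in _ + X]big1 ?addr0 //.
by move=> j; rewrite -leqNgt => /G0.
Qed.

Let sE : s = \sum_(j < N | (j < q)%N) cc (beta j) * x j.
Proof. by apply: sum_below => j /above[-> _]; rewrite rmorph0 mul0r. Qed.

Let cps_scale (c : K) (p : {mpoly K[N]}) : cps_of_mpoly (c *: p) = cc c * cps_of_mpoly p.
Proof. by rewrite -mul_mpolyC rmorphM. Qed.

Let linear_formE :
  cps_of_mpoly (beta_k%:MP + \sum_j beta j *: ((z j)%:MP + 'X_j)) = cc lambda + s.
Proof.
rewrite rmorphD rmorph_sum lambdaE cconstD cconst_sum /= -addrA; congr (_ + _).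
rewrite -big_split; apply: eq_bigr => j _ /=.
by rewrite cps_scale rmorphD /= mulrDr cconstM.
Qed.

Let cps_local_poly : cps_of_mpoly local_poly =
  1 + \sum_j (cc (z j) + x j) ^+ e.+1 + (cc lambda + s) ^+ e.+1.
Proof.
rewrite /local_poly !rmorphD rmorph1 rmorph_sum /= rmorphXn /= -linear_formE.
congr (_ + _ + _).
by apply: eq_bigr => j _; rewrite rmorphXn rmorphD.
Qed.

Let deriv_local_poly j : local_poly^`M(j) =
  e.+1%:R *: (((z j)%:MP + 'X_j) ^+ e
  + beta j *: (beta_k%:MP + \sum_i beta i *: ((z i)%:MP + 'X_i)) ^+ e).
Proof.
have dL i : ((z i)%:MP + 'X_i : {mpoly K[N]})^`M(j) = (i == j)%:R.
  by rewrite mderivD mderivC add0r mderiv_var.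
rewrite /local_poly !mderivD -{1}mpolyC1 mderivC add0r scalerDr; congr (_ + _).
  rewrite raddf_sum (bigD1 j) //= mderiv_exp dL eqxx mulr1 big1 ?addr0 // => i /negbTE ij.
  by rewrite mderiv_exp dL ij mulr0 scaler0.
have dS : (beta_k%:MP + \sum_i beta i *: ((z i)%:MP + 'X_i) : {mpoly K[N]})^`M(j) = (beta j)%:MP.
  rewrite mderivD mderivC add0r raddf_sum (bigD1 j) //=.
  rewrite mderivZ dL eqxx big1 ?addr0 ?alg_mpolyC //.
  by move=> i /negbTE ij; rewrite mderivZ dL ij scaler0.
by rewrite mderiv_exp dS mulrC mul_mpolyC.
Qed.

(** The left-hand side is, up to a nonzero factor, the determinant of the
    Hessian in the first [q] variables, a diagonal matrix plus one of rank 1.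
    By the critical equations [beta_j^2 / z_j^(e-1)] is
    [- beta_j z_j / lambda^e], so that the sum adds up to
    [(beta_k - lambda) / lambda] and the critical point is nondegenerate in
    these variables. *)
Lemma hessian_nondegenerate :
  1 + lambda ^+ e.-1 * \sum_(j < N | (j < q)%N) beta j ^+ 2 / z j ^+ e.-1 = beta_k / lambda.
Proof.
have eS : (e = e.-1.+1)%N by rewrite prednK // ltnW.
have -> : lambda ^+ e.-1 * \sum_(j < N | (j < q)%N) beta j ^+ 2 / z j ^+ e.-1 =
          \sum_(j < N | (j < q)%N) - (beta j * z j / lambda).
  rewrite mulr_sumr; apply: eq_bigr => j jq.
  have -> : beta j ^+ 2 = - beta j * (z j ^+ e / lambda ^+ e).
    by rewrite critical mulfK ?expf_neq0 // mulrNN expr2.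
  rewrite [in z j ^+ e]eS [in lambda ^+ e]eS !exprS; field.
  by rewrite lambda_neq0 z_pow_neq0 ?lambda_pow_neq0.
rewrite sumrN -mulr_suml -sum_below; last by move=> j /above[-> _]; rewrite mul0r.
have -> : \sum_j beta j * z j = lambda - beta_k by rewrite lambdaE addrC addKr.
by field.
Qed.

(** Taylor expansion at the critical point. The constant terms cancel by
    Euler's identity and the linear terms by the critical equations; since
    [z_j = 0] for [q <= j], the last variables only enter through their
    pure powers. *)
Lemma local_expansion : exists (psi : 'I_N -> cps N K) (psi_s : cps N K),
  [/\ forall j : 'I_N, (j < q)%N -> const_term (psi j) = 'C(e.+1, 2)%:R * z j ^+ e.-1,
      const_term psi_s = 'C(e.+1, 2)%:R * lambda ^+ e.-1 &
      cps_of_mpoly local_poly =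
        \sum_(j < N | (j < q)%N) x j ^+ 2 * psi j
        + \sum_(j < N | (q <= j)%N) x j ^+ e.+1 + s ^+ 2 * psi_s].
Proof.
have [psi_s psi_s0 psi_sE] := taylor2 e.+1 lambda s0.
have /choice[psi psiP] j : exists psi, const_term psi = 'C(e.+1, 2)%:R * z j ^+ e.-1 /\
    (cc (z j) + x j) ^+ e.+1 =
      cc (z j ^+ e.+1) + cc (e.+1%:R * z j ^+ e) * x j + x j ^+ 2 * psi.
  have [psi h1 h2] := taylor2 e.+1 (z j) (const_term_cX K j).
  by exists psi; rewrite h1 subSS subn1.
exists psi, psi_s; split; first by move=> j _; case: (psiP j).
  by rewrite psi_s0 subSS subn1.
have constant_part : 1 + \sum_(j < N | (j < q)%N) cc (z j ^+ e.+1) + cc (lambda ^+ e.+1) = 0.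
  rewrite -cconst_sum -[1](rmorph1 cc) -!cconstD -[RHS](rmorph0 cc); congr (cc _).
  have -> : \sum_(j < N | (j < q)%N) z j ^+ e.+1 = - lambda ^+ e * (lambda - beta_k).
    rewrite [X in _ * (X - _)]lambdaE [X in _ * X]addrC addKr mulr_sumr.
    rewrite [RHS]sum_below; first by apply: eq_bigr => j _; rewrite exprSr critical; ring.
    by move=> j /above[-> _]; rewrite mul0r mulr0.
  by rewrite exprSr {1}critical_k; ring.
have linear_part : \sum_(j < N | (j < q)%N) cc (e.+1%:R * z j ^+ e) * x j
                   + cc (e.+1%:R * lambda ^+ e) * s = 0.
  rewrite sE mulr_sumr -big_split big1 //= => j _.
  rewrite mulrA -cconstM -mulrDl -cconstD critical.
  have -> : e.+1%:R * (- beta j * lambda ^+ e) + e.+1%:R * lambda ^+ e * beta j = 0 by ring.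
  by rewrite rmorph0 mul0r.
rewrite cps_local_poly [X in 1 + X](bigID (fun j : 'I_N => (j < q)%N)) /=.
rewrite [X in 1 + (_ + X)](eq_bigl (fun j : 'I_N => (q <= j)%N)); last by move=> j; rewrite -leqNgt.
rewrite [X in 1 + (_ + X)](eq_bigr (fun j => x j ^+ e.+1)); last first.
  by move=> j /above[_ ->]; rewrite rmorph0 add0r.
rewrite psi_sE [X in 1 + (X + _)](eq_bigr (fun j =>
  (cc (z j ^+ e.+1) + cc (e.+1%:R * z j ^+ e) * x j) + x j ^+ 2 * psi j)); last first.
  by move=> j jq; have [_] := psiP j.
rewrite !big_split /=.
rewrite -[RHS]addr0 -[X in _ = _ + X]constant_part -[RHS]addr0 -[X in _ = _ + X]linear_part /=.
ring.
Qed.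

(** The Morse lemma, made explicit. With [eta_j] and [h] square roots of the
    second order Taylor coefficients, the equation is
    [sum_(j < q) (eta_j x_j)^2 + (h s)^2 + sum_(q <= j) x_j^(e+1)], and [h s] is
    a combination [sum b_j eta_j x_j] with [b_j = h beta_j / eta_j]; what
    remains is the diagonalization of a form of the shape identity plus
    rank 1. *)
Lemma local_morse : exists y : 'I_N -> cps N K, analytic_coordinates y /\
  cps_of_mpoly local_poly =
  \sum_(j < N | (j < q)%N) y j ^+ 2 + \sum_(j < N | (q <= j)%N) y j ^+ e.+1.
Proof.
have [psi [psi_s [psi0 psi_s0 ->]]] := local_expansion.
(* Taking eta_j = 1 for q <= j treats all the coordinates alike. *)
have /choice[eta_inv etaP] (j : 'I_N) : exists h : cps N K * cps N K,
   [/\ h.1 * h.2 = 1, (j < q)%N -> h.1 ^+ 2 = psi j & (q <= j)%N -> h.1 = 1].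
  have [jq|jq] := ltnP j q; last by exists (1, 1); split=> //=; rewrite mulr1.
  have nz : const_term (psi j) != 0 by rewrite psi0 // mulf_neq0 ?z_pow_neq0.
  have [h h0 hE] := cps_sqrt nz; have [i hi] := cps_inverse h0.
  by exists (h, i).
have psi_s_neq0 : const_term psi_s != 0 by rewrite psi_s0 mulf_neq0.
have [h h0 hE] := cps_sqrt psi_s_neq0.
have h_sq0 : const_term h ^+ 2 = 'C(e.+1, 2)%:R * lambda ^+ e.-1.
  by rewrite -rmorphXn /= hE psi_s0.
pose eta j := (eta_inv j).1; pose eta' j := (eta_inv j).2.
have etaK j : eta j * eta' j = 1 by have [] := etaP j.
have etaK0 j : const_term (eta j) * const_term (eta' j) = 1.
  by rewrite -rmorphM /= etaK rmorph1.
have eta_neq0 j : const_term (eta j) != 0.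
  by apply/eqP => eta0; have /eqP := etaK0 j; rewrite eta0 mul0r eq_sym oner_eq0.
pose b j := h * cc (beta j) * eta' j; pose Y j := eta j * x j.
have b_above (j : 'I_N) : (q <= j)%N -> b j = 0.
  by move=> /above[beta0 _]; rewrite /b beta0 rmorph0 mulr0 mul0r.
have wE : \sum_j b j * Y j = h * s.
  rewrite mulr_sumr; apply: eq_bigr => j _; rewrite /b /Y.
  by rewrite -[RHS]mulr1 -(etaK j); ring.
have Y_const i : const_term (Y i) = 0 by rewrite rmorphM /= const_term_cX mulr0.
have Y_linear i j : linear_coef j (Y i) = const_term (eta i) * (i == j)%:R.
  rewrite linear_coefM const_term_cX mulr0 addr0.
  by congr (_ * _); rewrite /linear_coef /cX /= /fps_of_mpoly mcoeffXU.
have sigma1 : 1 + const_term (\sum_j b j ^+ 2) != 0.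
  suff -> : 1 + const_term (\sum_j b j ^+ 2) = beta_k / lambda.
    by rewrite mulf_neq0 ?invr_eq0.
  rewrite -hessian_nondegenerate sum_below; last by move=> j /b_above ->; rewrite expr0n.
  rewrite rmorph_sum mulr_sumr; congr (1 + _); apply: eq_bigr => j jq.
  rewrite rmorphXn /b !rmorphM /= const_term_cconst !exprMn h_sq0.
  have eta_sq : const_term (eta j) ^+ 2 = 'C(e.+1, 2)%:R * z j ^+ e.-1.
    by have [_ /(_ jq) hj _] := etaP j; rewrite -rmorphXn /= hj psi0.
  have -> : const_term (eta' j) ^+ 2 = ('C(e.+1, 2)%:R * z j ^+ e.-1)^-1.
    apply: (mulfI (expf_neq0 2 (eta_neq0 j))).
    by rewrite -exprMn etaK0 expr1n eta_sq divff // mulf_neq0 ?z_pow_neq0.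
  by field; rewrite bin_neq0 z_pow_neq0.
have [c] := rank_one_morse eta_neq0 Y_const Y_linear sigma1.
rewrite wE; set y := fun j => _ => -[coord sumy]; exists y; split=> //.
have y_above (j : 'I_N) : (q <= j)%N -> y j = x j.
  move=> jq; have [_ _ /(_ jq) eta1] := etaP j.
  by rewrite /y b_above // mulr0 mul0r addr0 /Y /eta eta1 mul1r.
have -> : \sum_(j < N | (q <= j)%N) y j ^+ e.+1 = \sum_(j < N | (q <= j)%N) x j ^+ e.+1.
  by apply: eq_bigr => j /y_above ->.
(* The squares of the coordinates with q <= j occur on both sides of sumy. *)
have sum_split (G : 'I_N -> cps N K) : \sum_j G j =
    \sum_(j < N | (j < q)%N) G j + \sum_(j < N | (q <= j)%N) G j.
  rewrite (bigID (fun j : 'I_N => (j < q)%N)) /=; congr (_ + _).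
  by apply: eq_bigl => j; rewrite -leqNgt.
have Y_above : \sum_(j < N | (q <= j)%N) Y j ^+ 2 = \sum_(j < N | (q <= j)%N) y j ^+ 2.
  apply: eq_bigr => j jq; rewrite y_above // /Y; have [_ _ /(_ jq) eta1] := etaP j.
  by rewrite /eta eta1 mul1r.
have Y_below : \sum_(j < N | (j < q)%N) Y j ^+ 2 = \sum_(j < N | (j < q)%N) x j ^+ 2 * psi j.
  apply: eq_bigr => j jq; have [_ /(_ jq) eta_sq _] := etaP j.
  by rewrite /Y exprMn [eta j ^+ 2]eta_sq mulrC.
rewrite !sum_split Y_above Y_below in sumy.
have -> : \sum_(j < N | (j < q)%N) y j ^+ 2 =
          \sum_(j < N | (j < q)%N) x j ^+ 2 * psi j + (h * s) ^+ 2.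
  by apply: (addIr (\sum_(j < N | (q <= j)%N) y j ^+ 2)); rewrite sumy; ring.
by rewrite exprMn hE; ring.
Qed.

Definition jacobian_exponent (j : 'I_N) := if (j < q)%N then 1%N else e.

Let mon : seq (cps N K) := [seq x j ^+ jacobian_exponent j | j <- enum 'I_N].

Let mon_mem j : in_ideal mon (x j ^+ jacobian_exponent j).
Proof. by apply: in_ideal_mem; apply: map_f; rewrite mem_enum. Qed.

Let mon_below (j : 'I_N) : (j < q)%N -> in_ideal mon (x j).
Proof. by move=> jq; have := mon_mem j; rewrite /jacobian_exponent jq expr1. Qed.

Let mon_above (j : 'I_N) : (q <= j)%N -> in_ideal mon (x j ^+ e).
Proof. by move=> jq; have := mon_mem j; rewrite /jacobian_exponent ltnNge jq. Qed.

Let mon_s : in_ideal mon s.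
Proof. by rewrite sE; apply: in_ideal_sum => j jq; apply/in_idealMl/mon_below. Qed.

(** Up to a constant the partial derivatives are
    [theta_j x_j + beta_j theta s] for [j < q] and [x_j^e] for [q <= j], with
    [theta] and [theta_j] units. Dividing the former by [theta_j] and adding
    them up with weights [beta_j] gives a unit times [s], by nondegeneracy of
    the Hessian; hence [s], and then every [x_j] with [j < q], lies in the
    Jacobian ideal. *)
Lemma local_jacobian g : in_ideal (jacobian_gens local_poly) g <->
  exists c : 'I_N -> cps N K, g = \sum_j c j * x j ^+ jacobian_exponent j.
Proof.
rewrite -in_ideal_family -/mon.
have [theta theta0 thetaE] := taylor1 e lambda s0.
have /choice[th thP] j : exists t, const_term t = e%:R * z j ^+ e.-1 /\
    (cc (z j) + x j) ^+ e = cc (z j ^+ e) + x j * t.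
  by have [t h1 h2] := taylor1 e (z j) (const_term_cX K j); exists t.
pose D j := x j * th j + cc (beta j) * (s * theta).
have derE j : cps_of_mpoly local_poly^`M(j) = cc e.+1%:R * D j.
  rewrite deriv_local_poly cps_scale; congr (_ * _).
  rewrite rmorphD rmorphXn /= cps_scale rmorphXn /= linear_formE rmorphD /=.
  have [_ ->] := thP j; rewrite thetaE critical /D mulrDr -cconstM.
  rewrite addrACA -cconstD.
  have -> : - beta j * lambda ^+ e + beta j * lambda ^+ e = 0 by ring.
  by rewrite rmorph0 add0r.
have D_above (j : 'I_N) : (q <= j)%N -> D j = x j ^+ e.
  move=> /above[betaj zj]; rewrite /D betaj rmorph0 mul0r addr0.
  have [_] := thP j; rewrite zj rmorph0 add0r expr0n => ->.
  by rewrite gtn_eqF ?rmorph0 ?add0r // ltnW.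
split; apply: in_ideal_trans => f /mapP[j _ ->].
  rewrite derE; apply: in_idealMl; have [jq|jq] := ltnP j q; last first.
    by rewrite D_above //; apply: mon_above.
  apply: in_idealD; first by rewrite mulrC; apply/in_idealMl/mon_below.
  by apply: in_idealMl; rewrite mulrC; apply: in_idealMl.
set J := jacobian_gens _.
have JD i : in_ideal J (D i).
  have -> : D i = cc e.+1%:R^-1 * cps_of_mpoly local_poly^`M(i).
    by rewrite derE mulrA -cconstM mulVf // rmorph1 mul1r.
  by apply/in_idealMl/in_ideal_mem/map_f; rewrite mem_enum.
have th_neq0 (i : 'I_N) : (i < q)%N -> const_term (th i) != 0.
  by move=> iq; have [-> _] := thP i; rewrite mulf_neq0 ?z_pow_neq0.
have /choice[th' thK] (i : 'I_N) : exists t, (i < q)%N -> th i * t = 1.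
  have [iq|iq] := ltnP i q; last by exists 0.
  by have [t h] := cps_inverse (th_neq0 i iq); exists t.
have th'0 (i : 'I_N) : (i < q)%N -> const_term (th' i) = (e%:R * z i ^+ e.-1)^-1.
  move=> iq; have [h _] := thP i; apply: (mulfI (th_neq0 i iq)).
  by rewrite -rmorphM /= thK // rmorph1 -h divff ?th_neq0.
pose u := 1 + theta * \sum_(i < N | (i < q)%N) cc (beta i) ^+ 2 * th' i.
have u0 : const_term u != 0.
  rewrite /u rmorphD rmorph1 rmorphM rmorph_sum /= theta0.
  suff -> : e%:R * lambda ^+ e.-1 *
      \sum_(i < N | (i < q)%N) const_term (cc (beta i) ^+ 2 * th' i)
      = lambda ^+ e.-1 * \sum_(j < N | (j < q)%N) beta j ^+ 2 / z j ^+ e.-1.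
    by rewrite hessian_nondegenerate mulf_neq0 // invr_eq0.
  rewrite !mulr_sumr; apply: eq_bigr => i iq.
  rewrite rmorphM rmorphXn /= const_term_cconst th'0 //; field.
  by rewrite e_neq0 z_pow_neq0.
have Js : in_ideal J s.
  have [v uv] := cps_inverse u0.
  rewrite -[s]mul1r -uv [u * v]mulrC -mulrA; apply: in_idealMl.
  have -> : u * s = \sum_(i < N | (i < q)%N) (cc (beta i) * th' i) * D i.
    transitivity (s + \sum_(i < N | (i < q)%N) theta * (cc (beta i) ^+ 2 * th' i) * s).
      by rewrite /u mulrDl mul1r -mulr_suml -mulr_sumr.
    rewrite [X in X + _]sE -big_split.
    apply: eq_bigr => i iq /=; rewrite /D mulrDr.
    have -> : cc (beta i) * th' i * (x i * th i) = cc (beta i) * x i * (th i * th' i) by ring.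
    by rewrite thK // mulr1; ring.
  by apply: in_ideal_sum => i _; apply: in_idealMl.
have [jq|jq] := ltnP j q; rewrite /jacobian_exponent; last first.
  by rewrite ltnNge jq /= -D_above.
rewrite jq expr1.
have -> : x j = th' j * D j + (- th' j * cc (beta j) * theta) * s.
  by rewrite -[LHS]mulr1 -(thK j jq) /D; ring.
by apply: in_idealD; apply: in_idealMl.
Qed.

Let local_poly_in_jacobian : in_ideal (jacobian_gens local_poly) (cps_of_mpoly local_poly).
Proof.
apply/local_jacobian/in_ideal_family; rewrite -/mon.
have [psi [psi_s [_ _ ->]]] := local_expansion.
apply: in_idealD; last by rewrite expr2 mulrAC; apply: in_idealMl.
apply: in_idealD; apply: in_ideal_sum => j jq.
  by rewrite expr2 mulrAC; apply/in_idealMl/mon_below.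
by rewrite exprS; apply/in_idealMl/mon_above.
Qed.

Let prod_jacobian_exponent : (\prod_j jacobian_exponent j = e ^ (N - q))%N.
Proof.
rewrite /jacobian_exponent; elim: (N) => [|n IH]; first by rewrite big_ord0.
rewrite big_ord_recr /= IH; case: ltnP => [nq|qn]; last by rewrite subSn // expnSr.
have /eqP -> : (n - q == 0)%N by rewrite subn_eq0 ltnW.
by have /eqP -> : (n.+1 - q == 0)%N by rewrite subn_eq0.
Qed.

Lemma local_milnor_dim : quotient_dim (jacobian_gens local_poly) (e ^ (N - q)).
Proof. by rewrite -prod_jacobian_exponent; apply: monomial_ideal_quotient_dim local_jacobian. Qed.

(** The equation already lies in its Jacobian ideal: each term of its
    expansion does. *)
Lemma local_tjurina_dim :
  quotient_dim (cps_of_mpoly local_poly :: jacobian_gens local_poly) (e ^ (N - q)).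
Proof.
rewrite -prod_jacobian_exponent; apply: monomial_ideal_quotient_dim => g.
rewrite -local_jacobian; split; apply: in_ideal_trans => f; last first.
  by move=> fJ; apply: in_ideal_mem; rewrite inE fJ orbT.
rewrite inE => /orP[/eqP ->|]; first exact: local_poly_in_jacobian.
exact: in_ideal_mem.
Qed.

End LocalNormalForm.

(** * Singular points of the normal form *)

Section LinearForms.
Variables (n : nat) (K : numFieldType).

Lemma meval_linear_form (l v : 'rV[K]_n) : (linear_form l).@[v 0] = \sum_j l 0 j * v 0 j.
Proof. by rewrite raddf_sum; apply: eq_bigr => j _; rewrite /= mevalZ mevalXU. Qed.

Lemma mderiv_linear_form (l : 'rV[K]_n) j : (linear_form l)^`M(j) = (l 0 j)%:MP.
Proof.
rewrite raddf_sum (bigD1 j) //= mderivZ mderiv_var eqxx big1 ?addr0 ?alg_mpolyC //.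
by move=> i /negbTE ij; rewrite mderivZ mderiv_var ij scaler0.
Qed.

(** The normal form with coefficients in all the variables, zero or not. *)
Definition bordered_fermat (d : nat) (b : 'rV[K]_n) : {mpoly K[n]} :=
  \sum_i 'X_i ^+ d + linear_form b ^+ d.

Definition pad m (a : 'rV[K]_m.+1) : 'rV[K]_n :=
  \row_(i < n) if (i <= m)%N then a 0 (inord i) else 0.

Lemma normal_formE d m (a : 'rV[K]_m.+1) :
  normal_form n d a = bordered_fermat d (pad a).
Proof.
rewrite /normal_form /bordered_fermat; congr (_ + _ ^+ _).
rewrite big_mkcond /=; apply: eq_bigr => i _; rewrite mxE.
by case: ifP => // _; rewrite scale0r.
Qed.

(** The vanishing of the equation itself follows from that of its partial
    derivatives by Euler's identity. *)
Lemma singular_bordered_fermat e (b p : 'rV[K]_n) :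
  singular_point (bordered_fermat e.+1 b) p <->
  p != 0 /\ forall i, p 0 i ^+ e = - b 0 i * (\sum_j b 0 j * p 0 j) ^+ e.
Proof.
have dF i : ((bordered_fermat e.+1 b)^`M(i)).@[p 0] =
    e.+1%:R * (p 0 i ^+ e + b 0 i * (\sum_j b 0 j * p 0 j) ^+ e).
  rewrite mderivD raddf_sum (bigD1 i) //= mderiv_exp mderiv_var eqxx mulr1.
  rewrite big1 ?addr0; last by move=> j /negbTE ji; rewrite mderiv_exp mderiv_var ji mulr0 scaler0.
  rewrite mderiv_exp mderiv_linear_form mevalD !mevalZ mevalM mevalC !rmorphXn /=.
  by rewrite mevalXU meval_linear_form mulrDr [_ ^+ e * _]mulrC.
have d0 : e.+1%:R != 0 :> K by rewrite pnatr_eq0.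
split=> [[p0 _ h]|[p0 h]].
  split=> // i; apply/eqP; rewrite mulNr -addr_eq0; apply/eqP.
  by apply: (mulfI d0); rewrite mulr0 -dF.
split=> // [|i]; last by rewrite dF h mulNr addNr mulr0.
rewrite mevalD raddf_sum /= rmorphXn /= meval_linear_form.
under eq_bigr => i _ do rewrite rmorphXn /= mevalXU exprSr h !mulNr mulrAC.
by rewrite sumrN -mulr_suml -exprS addNr.
Qed.

End LinearForms.

Lemma isolating_radius m (K : numFieldType) (s : seq 'rV[K]_m) (u0 : 'rV[K]_m) :
  exists2 eps : K, 0 < eps & forall u, u \in s ->
    (forall j, `|u 0 j - u0 0 j| < eps) -> u = u0.
Proof.
elim: s => [|v s [eps eps0 IH]]; first by exists 1.
have [->|vu] := eqVneq v u0.
  by exists eps => // u; rewrite inE => /orP[/eqP ->|/IH].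
have /rV0Pn[j] : v - u0 != 0 by rewrite subr_eq0.
rewrite !mxE => vj.
have vj0 : 0 < `|v 0 j - u0 0 j| by rewrite normr_gt0.
have [t t0 [t1 t2]] := pos_lower_bound eps0 vj0.
exists t => // u; rewrite inE => /orP[/eqP ->|us] h.
  by have := lt_le_trans (h j) t2; rewrite ltxx.
by apply: IH => // i; apply: lt_le_trans (h i) t1.
Qed.

Section Solutions.
Variables (m e : nat) (K : numClosedFieldType) (a : 'rV[K]_m.+1).
Hypotheses (e_gt0 : (0 < e)%N) (a_neq0 : forall j, a 0 j != 0).

Lemma solutionP (u : 'rV[K]_m) : solution e.+1 a u <->
  (forall i, a 0 ord_max * u 0 i ^+ e = a 0 (lift ord_max i)) /\
  a 0 ord_max * (\sum_i a 0 (lift ord_max i) * u 0 i + a 0 ord_max) ^+ e + 1 = 0.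
Proof.
have ev_lift i : (system e.+1 a (lift ord_max i)).@[u 0] =
    a 0 ord_max * u 0 i ^+ e - a 0 (lift ord_max i).
  by rewrite /system liftK /= mevalB mevalZ mevalC rmorphXn /= mevalXU.
have ev_max : (system e.+1 a ord_max).@[u 0] =
    a 0 ord_max * (\sum_i a 0 (lift ord_max i) * u 0 i + a 0 ord_max) ^+ e + 1.
  rewrite /system unlift_none /= mevalD mevalZ meval1 rmorphXn /= mevalD mevalC raddf_sum /=.
  congr (_ * (_ + _) ^+ _ + _).
  by apply: eq_bigr => i _; rewrite mevalZ mevalXU.
split=> [h|[h1 h2] j].
  split=> [i|]; last by rewrite -ev_max h.
  by apply/eqP; rewrite -subr_eq0 -ev_lift h.
case: (unliftP ord_max j) => [i ->|->]; last by rewrite ev_max.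
by rewrite ev_lift h1 subrr.
Qed.

(** The first equations of the system leave finitely many values for each
    coordinate. *)
Lemma solutions_finite : exists N, number_of_solutions e.+1 a N.
Proof.
have roots (i : 'I_m) : exists s : seq K, forall c,
    a 0 ord_max * c ^+ e = a 0 (lift ord_max i) -> c \in s.
  pose P : {poly K} := a 0 ord_max *: 'X^e - (a 0 (lift ord_max i))%:P.
  have P0 : P != 0.
    apply/eqP => /polyP /(_ 0%N); rewrite coefB coefZ coefXn coefC coef0 /=.
    by rewrite ltn_eqF // mulr0 sub0r => /eqP; rewrite oppr_eq0 (negbTE (a_neq0 _)).
  have [s sE] := closed_field_poly_normal P.
  exists s => c hc; have : root P c by rewrite rootE !hornerE hc subrr.
  by rewrite sE rootZ ?lead_coef_eq0 // root_prod_XsubC.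
have {roots} [S SP] := choice roots.
pose T := flatten [seq S i | i <- enum 'I_m].
pose cand := [seq (\row_i T`_(f i)) | f : {ffun 'I_m -> 'I_(size T)}] : seq 'rV[K]_m.
pose s := undup [seq u <- cand | `[< solution e.+1 a u >]].
suff key (u : 'rV[K]_m) : u \in s <-> solution e.+1 a u.
  by exists (size s), s; first by rewrite undup_uniq.
rewrite mem_undup mem_filter; split=> [/andP[/asboolP]//|hu].
apply/andP; split; first exact/asboolP.
have uT i : u 0 i \in T.
  apply/flattenP; exists (S i); first by apply: map_f; rewrite mem_enum.
  by apply: SP; have /solutionP[] := hu.
have lt (i : 'I_m) : (index (u 0%R i) T < size T)%N by rewrite index_mem.
apply/imageP; exists [ffun i => Ordinal (lt i)] => //.
by apply/rowP => i; rewrite mxE ffunE /= nth_index.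
Qed.

End Solutions.

Section Geometry.
Variables (N q e : nat) (K : numClosedFieldType) (a : 'rV[K]_q.+1).
Hypotheses (e_gt1 : (1 < e)%N) (qN : (q <= N)%N) (a_neq0 : forall j, a 0 j != 0).

(* kap is the index of the last variable that occurs in the extra linear form. *)
Let b : 'rV[K]_N.+1 := pad N.+1 a.
Let kap : 'I_N.+1 := inord q.
Let F := normal_form N.+1 e.+1 a.
Local Notation pt := (@point_of_solution N.+1 q K).
Let e_gt0 : (0 < e)%N := ltnW e_gt1.

Let kapE : kap = q :> nat. Proof. by rewrite inordK. Qed.

Let b_low (i : 'I_N.+1) : (i <= q)%N -> b 0 i = a 0 (inord i).
Proof. by move=> h; rewrite mxE h. Qed.

Let b_low_neq0 (i : 'I_N.+1) : (i <= q)%N -> b 0 i != 0.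
Proof. by move=> h; rewrite b_low. Qed.

Let b_high (i : 'I_N.+1) : (q < i)%N -> b 0 i = 0.
Proof. by move=> h; rewrite mxE leqNgt h. Qed.

Let b_kap : b 0 kap = a 0 ord_max.
Proof. by rewrite b_low ?kapE //; congr (a 0 _); apply: val_inj; rewrite /= inordK. Qed.

Let pt_low (u : 'rV[K]_q) (i : 'I_q) (i' : 'I_N.+1) : i' = i :> nat -> pt u 0 i' = u 0 i.
Proof. by move=> ii'; rewrite mxE ii' valK. Qed.

Let pt_kap (u : 'rV[K]_q) : pt u 0 kap = 1.
Proof. by rewrite mxE insubF ?kapE ?ltnn // eqxx. Qed.

Let pt_high (u : 'rV[K]_q) (i : 'I_N.+1) : (q < i)%N -> pt u 0 i = 0.
Proof. by move=> qi; rewrite mxE insubF ?gtn_eqF // ltnNge ltnW. Qed.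

Let wide (i : 'I_q) : (inord i : 'I_N.+1) = i :> nat.
Proof. by rewrite inordK // ltnS (leq_trans (ltnW (ltn_ord i))). Qed.

Let narrow (i : 'I_q) : inord i = lift ord_max i :> 'I_q.+1.
Proof.
apply: val_inj; rewrite /= inordK; last by rewrite ltnS ltnW.
by rewrite /bump leqNgt ltn_ord.
Qed.
Let wide_le (i : 'I_q) : ((inord i : 'I_N.+1) <= q)%N.
Proof. by rewrite wide ltnW. Qed.

Let sum_pt (u : 'rV[K]_q) : \sum_i b 0 i * pt u 0 i =
  \sum_i a 0 (lift ord_max i) * u 0 i + a 0 ord_max.
Proof.
pose f (i : nat) : K := if (i < q.+1)%N then b 0 (inord i) * pt u 0 (inord i) else 0.
transitivity (\sum_(i < N.+1) f i).
  apply: eq_bigr => i _; rewrite /f inord_val ltnS; case: leqP => // qi.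
  by rewrite b_high // mul0r.
rewrite -(big_mkord xpredT f) (@big_cat_nat _ _ _ q.+1) //= [X in _ + X]big1_seq ?addr0; last first.
  by move=> i; rewrite mem_index_iota /f => /andP[_ /andP[qi _]]; rewrite ltnNge qi.
rewrite big_mkord big_ord_recr /= /f ltnSn; congr (_ + _); last by rewrite pt_kap b_kap mulr1.
apply: eq_bigr => i _; rewrite ltnS (ltnW (ltn_ord i)).
by rewrite (pt_low u (wide i)) b_low ?wide_le // wide narrow.
Qed.

Let singularP p : singular_point F p <->
  p != 0 /\ forall i, p 0 i ^+ e = - b 0 i * (\sum_j b 0 j * p 0 j) ^+ e.
Proof. by rewrite /F normal_formE; apply: singular_bordered_fermat. Qed.

Lemma solution_singular u : solution e.+1 a u -> singular_point F (pt u).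
Proof.
move=> /solutionP[h1 h2]; apply/singularP; split.
  by apply/eqP => /rowP /(_ kap); rewrite pt_kap mxE => /eqP; rewrite oner_eq0.
rewrite sum_pt => i; set L := (X in X ^+ e) in h2 *.
have Lk : 1 = - a 0 ord_max * L ^+ e by rewrite mulNr; apply/eqP; rewrite -addr_eq0 addrC h2.
case: (ltngtP i q) => iq; last first.
- have -> : i = kap by apply: val_inj; rewrite /= kapE.
  by rewrite pt_kap b_kap expr1n.
- by rewrite pt_high // b_high // oppr0 mul0r expr0n gtn_eqF.
pose i' := Ordinal iq; rewrite (@pt_low u i') // b_low; last exact: ltnW.
rewrite (narrow i').
by rewrite -h1 -[LHS]mul1r Lk; ring.
Qed.

Lemma singular_scale p c : c != 0 -> singular_point F p -> singular_point F (c *: p).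
Proof.
move=> c0 /singularP[p0 h]; apply/singularP; split.
  by rewrite scaler_eq0 negb_or c0.
move=> i; rewrite mxE exprMn h.
have -> : \sum_j b 0 j * (c *: p) 0 j = c * \sum_j b 0 j * p 0 j.
  by rewrite mulr_sumr; apply: eq_bigr => j _; rewrite [(c *: p) 0 j]mxE mulrCA.
by rewrite exprMn; ring.
Qed.

(** At a singular point the extra linear form [L] does not vanish, for otherwise
    [p_i^e = - b_i L^e] would give [p = 0]; hence [p_i] vanishes exactly where
    [b_i] does. *)
Lemma singular_support p : singular_point F p ->
  [/\ \sum_j b 0 j * p 0 j != 0, forall i : 'I_N.+1, (i <= q)%N -> p 0 i != 0 &
      forall i : 'I_N.+1, (q < i)%N -> p 0 i = 0].
Proof.
move=> /singularP[p0 h]; set L := \sum_j _ in h *.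
have L0 : L != 0.
  apply: contra_neq p0 => L0; apply/rowP => i; rewrite mxE.
  by apply/eqP; have /eqP := h i; rewrite L0 expr0n gtn_eqF // mulr0 expf_eq0 e_gt0.
split=> // i qi; last first.
  by apply/eqP; have /eqP := h i; rewrite b_high // oppr0 mul0r expf_eq0 e_gt0.
have : p 0 i ^+ e != 0 by rewrite h mulf_neq0 ?oppr_eq0 ?b_low_neq0 ?expf_neq0.
by rewrite expf_eq0 e_gt0.
Qed.

Lemma singular_solution p : singular_point F p ->
  exists2 u, solution e.+1 a u & p = p 0 kap *: pt u.
Proof.
move=> sp; have [L0 plow phigh] := singular_support sp.
have pk0 : p 0 kap != 0 by rewrite plow // kapE.
pose u : 'rV[K]_q := \row_i (p 0 (inord i) / p 0 kap).
have pE : p = p 0 kap *: pt u.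
  apply/rowP => i; rewrite mxE; case: (ltngtP i q) => iq; last first.
  - have -> : i = kap by apply: val_inj; rewrite /= kapE.
    by rewrite pt_kap mulr1.
  - by rewrite pt_high // mulr0 phigh.
  by rewrite (@pt_low u (Ordinal iq)) // mxE /= inord_val mulrC divfK.
exists u => //.
have /singularP[_ h] : singular_point F (pt u).
  have -> : pt u = (p 0 kap)^-1 *: p by rewrite {2}pE scalerA mulVf // scale1r.
  by apply: singular_scale; rewrite ?invr_eq0.
rewrite sum_pt in h; set L := _ + _ in h.
have hk : 1 = - a 0 ord_max * L ^+ e by rewrite -b_kap -h pt_kap expr1n.
apply/solutionP; split=> [i|]; last first.
  by apply/eqP; rewrite addrC addr_eq0 -mulNr; apply/eqP.
have := h (inord i); rewrite (pt_low u (wide i)) => ->.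
rewrite b_low ?wide_le // wide narrow.
by rewrite -[RHS]mulr1 hk; ring.
Qed.

Lemma singular_pointP p : singular_point F p <->
  exists2 u, solution e.+1 a u & proj_eq (pt u) p.
Proof.
split=> [sp|[u su [c c0 ->]]]; last exact: singular_scale c0 (solution_singular su).
have [u su pE] := singular_solution sp; exists u => //.
have [_ plow _] := singular_support sp.
by exists (p 0 kap); first by rewrite plow // kapE.
Qed.

Lemma pt_inj u u' : proj_eq (pt u) (pt u') -> u = u'.
Proof.
move=> [c _ /rowP h]; have c1 : c = 1.
  by have := h kap; rewrite [(c *: pt u) 0 kap]mxE !pt_kap mulr1.
apply/rowP => i.
by have := h (inord i); rewrite [(c *: pt u) 0 (inord i)]mxE c1 mul1r !(pt_low _ (wide i)).
Qed.

(** The points of the singular locus in the chart are the finitely many solutions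
    of the system, so a small ball around one of them avoids the others. *)
Lemma singular_isolated p : singular_point F p -> isolated_singularity F p.
Proof.
move=> sp; have [_ plow _] := singular_support sp.
have pk0 : p 0 kap != 0 by rewrite plow // kapE.
have [u0 su0 pE] := singular_solution sp.
have [_ [s _ sP]] := solutions_finite e_gt0 a_neq0.
have [eps eps0 epsP] := isolating_radius s u0.
exists kap; split=> //; exists eps => // r sr rk near.
have [u su rE] := singular_solution sr.
suff uu0 : u = u0.
  exists (r 0 kap / p 0 kap); first by rewrite mulf_neq0 ?invr_eq0.
  by rewrite {1}rE uu0 {2}pE scalerA divfK //.
apply: epsP; first exact/sP.
move=> i; have := near (inord i).
have ratio (v v' : 'rV[K]_N.+1) (c : K) : v' = c *: v -> c != 0 -> v 0 kap = 1 ->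
    v' 0 (inord i) / v' 0 kap = v 0 (inord i) :> K.
  by move=> -> c0 vk; rewrite !mxE vk mulr1 mulrC mulKf.
rewrite (ratio _ _ _ rE) ?pt_kap // (ratio _ _ _ pE) ?pt_kap //.
by rewrite !(pt_low _ (wide i)).
Qed.

Section AtSingularPoint.
Variable p : 'rV[K]_N.+1.
Hypothesis sing_p : singular_point F p.

Let z (j : 'I_N) : K := p 0 (lift kap j) / p 0 kap.
Let beta (j : 'I_N) : K := b 0 (lift kap j).
Let lambda : K := b 0 kap + \sum_j beta j * z j.

Let pk0 : p 0 kap != 0.
Proof. by have [_ plow _] := singular_support sing_p; rewrite plow // kapE. Qed.

Let sum_kap (f : 'I_N.+1 -> K) : \sum_i f i = f kap + \sum_j f (lift kap j).
Proof. by rewrite (bigD1_ord kap). Qed.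

Let lambdaE : lambda = (\sum_j b 0 j * p 0 j) / p 0 kap.
Proof.
rewrite sum_kap mulrDl mulfK //; congr (_ + _); rewrite mulr_suml.
by apply: eq_bigr => j _; rewrite mulrA.
Qed.

Let lambda_neq0 : lambda != 0.
Proof.
have [L0 _ _] := singular_support sing_p.
by rewrite lambdaE mulf_neq0 ?invr_eq0.
Qed.

Let critical i : (p 0 i / p 0 kap) ^+ e = - b 0 i * lambda ^+ e.
Proof. by have /singularP[_ h] := sing_p; rewrite lambdaE !expr_div_n h mulrA. Qed.

Let critical_k : 1 = - b 0 kap * lambda ^+ e.
Proof. by rewrite -critical divff // expr1n. Qed.

Let lift_low (j : 'I_N) : (j < q)%N -> (lift kap j <= q)%N.
Proof. by move=> jq; rewrite /= /bump kapE [(q <= j)%N]leqNgt jq ltnW. Qed.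

Let lift_high (j : 'I_N) : (q <= j)%N -> (q < lift kap j)%N.
Proof. by move=> jq; rewrite /= /bump kapE jq ltnS. Qed.

Let below (j : 'I_N) : (j < q)%N -> beta j != 0 /\ z j != 0.
Proof.
move=> /lift_low jq; have [_ plow _] := singular_support sing_p.
split; first exact: b_low_neq0.
by rewrite /z mulf_neq0 ?invr_eq0 // plow.
Qed.

Let above (j : 'I_N) : (q <= j)%N -> beta j = 0 /\ z j = 0.
Proof.
move=> /lift_high jq; have [_ _ phigh] := singular_support sing_p.
by rewrite /z /beta b_high // phigh // mul0r.
Qed.

Let beta_k_neq0 : b 0 kap != 0. Proof. by rewrite b_low_neq0 // kapE. Qed.

Let chartE : local_equation F p kap = local_poly e z beta (b 0 kap).
Proof.
rewrite /F normal_formE -/b /local_equation; set t := (X in _ \mPo X).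
have tE i : 'X_i \mPo t = if unlift kap i is Some j then (z j)%:MP + 'X_j else 1.
  by rewrite comp_mpolyXU -tnth_nth tnth_mktuple; case: unliftP => [j ->|_].
have tk : 'X_kap \mPo t = 1 by rewrite tE unlift_none.
have tl j : 'X_(lift kap j) \mPo t = (z j)%:MP + 'X_j by rewrite tE liftK.
rewrite /bordered_fermat comp_mpolyD raddf_sum /= rmorphXn /=.
rewrite (bigD1_ord kap) //= rmorphXn /= tk expr1n /local_poly; congr (_ + _ + _ ^+ _).
  by apply: eq_bigr => j _; rewrite rmorphXn /= tl.
rewrite /linear_form raddf_sum (bigD1_ord kap) //= comp_mpolyZ tk alg_mpolyC.
by congr (_ + _); apply: eq_bigr => j _; rewrite comp_mpolyZ tl.
Qed.

Lemma singular_type_A : has_type_A q e.+1 F p.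
Proof.
exists kap; split=> //.
have [y [yc yE]] := local_morse e_gt1 beta_k_neq0 lambda_neq0 below above (erefl _) (fun j => critical _) critical_k.
exists y; split=> //; exists 1, 1; rewrite mulr1; split=> //.
by rewrite mul1r chartE.
Qed.

Lemma singular_milnor : local_milnor F p (e ^ (N - q)).
Proof.
exists kap; split=> //; rewrite chartE.
exact: (local_milnor_dim e_gt1 beta_k_neq0 lambda_neq0 below above (erefl _) (fun j => critical _)).
Qed.

Lemma singular_tjurina : local_tjurina F p (e ^ (N - q)).
Proof.
exists kap; split=> //; rewrite chartE.
exact: (local_tjurina_dim e_gt1 beta_k_neq0 lambda_neq0 below above (erefl _) (fun j => critical _) critical_k).
Qed.

End AtSingularPoint.

Lemma total_number (loc : 'rV[K]_N.+1 -> nat -> Prop) S :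
  number_of_solutions e.+1 a S ->
  (forall p, singular_point F p -> loc p (e ^ (N - q))%N) ->
  sum_over_singular_points loc F (S * e ^ (N - q))%N.
Proof.
move=> [s [us <-] sP] locP.
exists [seq pt u | u <- s], (fun=> e ^ (N - q))%N.
have sing p : p \in [seq pt u | u <- s] -> singular_point F p.
  by move=> /mapP[u /sP su ->]; apply: solution_singular.
split=> //.
- split.
    rewrite map_inj_uniq // => u u' e_uu'; apply: pt_inj.
    by exists 1; rewrite ?oner_eq0 // scale1r.
  by move=> _ _ /mapP[u _ ->] /mapP[u' _ ->] /pt_inj ->.
- move=> p /singular_pointP[u /sP us' up]; exists (pt u) => //.
  exact: map_f.
- by move=> p /sing /locP.
by rewrite big_map big_const_seq count_predT iter_addn_0 mulnC.
Qed.

End Geometry.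

(** * Irreducibility *)

Section HomogeneousFactors.
Variables (n : nat) (K : idomainType).
Implicit Types p g h : {mpoly K[n]}.

(** Substituting [t X_i] for [X_i] makes the homogeneous components the
    coefficients of a polynomial in [t]. *)
Definition grading p : {poly {mpoly K[n]}} :=
  mmap (polyC \o @mpolyC n K) (fun i => 'X_i *: 'X) p.

Lemma grading_coef p k m : ((grading p)`_k)@_m = if mdeg m == k then p@_m else 0.
Proof.
have gX (a : 'X_{1..n}) : mmap1 (fun i => 'X_i *: 'X : {poly {mpoly K[n]}}) a = 'X_[a] *: 'X^(mdeg a).
  rewrite /mmap1 mpolyXE_id mdegE.
  rewrite -mul_polyC rmorph_prod /= -prodrXr -big_split; apply: eq_bigr => i _ /=.
  by rewrite -mul_polyC exprMn rmorphXn.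
rewrite /grading /mmap coef_sum raddf_sum /=.
under eq_bigr => a _ do rewrite gX mul_polyC !coefZ coefXn mul_mpolyC mcoeffZ mulr_natr mcoeffMn mcoeffX.
have [pm|pm] := boolP (m \in msupp p); last first.
  rewrite (memN_msupp_eq0 pm) if_same big1_seq // => a /andP[_ ap].
  case: (a =P m) => [e|_]; last by rewrite mul0rn mulr0.
  by rewrite -e ap in pm.
rewrite (bigD1_seq m) //= eqxx big1 ?addr0; last first.
  by move=> a /negbTE ->; rewrite mul0rn mulr0.
by rewrite [k == _]eq_sym; case: eqP => _; rewrite ?mulr1 ?mulr0n ?mulr0.
Qed.

Lemma grading_homog d p : p \is d.-homog -> grading p = p *: 'X^d.
Proof.
move=> hp; apply/polyP => k; apply/mpolyP => m; rewrite grading_coef coefZ coefXn.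
case: eqP => [<-|mk]; case: eqP => [e|kd]; rewrite ?mulr1 ?mulr0 ?mcoeff0 //.
  by apply: (dhomog_nemf_coeff hp); apply/eqP.
by rewrite (dhomog_nemf_coeff hp) //= -e; apply/eqP.
Qed.

(** A divisor of a monomial [c t^d] is, up to constants, a power of [t]. *)
Lemma homogeneous_factor d g h : g * h \is d.-homog -> g * h != 0 ->
  exists k, g \is k.-homog.
Proof.
move=> hom gh0; have gM : grading (g * h) = grading g * grading h.
  by rewrite /grading rmorphM.
have : grading g %| ('X - 0%:P) ^+ d.
  rewrite subr0 -(dvdpZr _ _ gh0) -(grading_homog hom) gM dvdp_mulr //.
move=> /dvdp_exp_XsubCP[k _]; rewrite subr0 => /eqpP[[c1 c2] /= /andP[c10 c20] e].
exists k; apply/dhomogP => m mg; apply/eqP; apply: contraT => mk.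
have := congr1 (fun P : {poly {mpoly K[n]}} => P`_(mdeg m)) e.
rewrite !coefZ coefXn (negbTE mk) mulr0 => /eqP; rewrite mulf_eq0 (negbTE c10) /=.
move=> /eqP e0; have := grading_coef g (mdeg m) m.
by rewrite e0 mcoeff0 eqxx => /esym/eqP; rewrite mcoeff_eq0 mg.
Qed.

End HomogeneousFactors.

Section CompanionMatrices.

(** The dimension is a parameter, rather than one less than the size of a
    polynomial, so that specializing the coefficients preserves the type. *)
Definition companion (R : nzRingType) n (c : nat -> R) : 'M[R]_n :=
  \matrix_(i, j) if i == n.-1 :> nat then - c j else (i.+1 == j :> nat)%:R.

Lemma char_poly_companion (R : comNzRingType) n (p : {poly R}) :
  p \is monic -> size p = n.+1 -> char_poly (companion n (fun j => p`_j)) = p.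
Proof.
move=> p1 sp; have e : n = (size p).-1 by rewrite sp.
by rewrite e -[RHS](companionmxK p1).
Qed.

(** [\det Q(C)] is a resultant of [Q] and the characteristic polynomial of [C]:
    [Q(C)] is, up to a constant, the product of the [C - w] over the roots [w]
    of [Q]. *)
Lemma horner_mx_singularP (K : closedFieldType) n (C : 'M[K]_n.+1) (Q : {poly K}) :
  \det (horner_mx C Q) = 0 <-> exists2 w, root (char_poly C) w & root Q w.
Proof.
have eigen w : (\det (C - w%:M) == 0) = root (char_poly C) w.
  rewrite -eigenvalue_root_char /eigenvalue /eigenspace kermx_eq0 row_free_unit.
  by rewrite unitmxE unitfE negbK.
have hornerX w : horner_mx C ('X - w%:P) = C - w%:M.
  by rewrite rmorphB /= horner_mx_X horner_mx_C.
split=> [|[w]]; last first.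
  rewrite -eigen => /eqP dC /factor_theorem[Q1 ->].
  by rewrite rmorphM /= det_mulmx hornerX dC mulr0.
have [->|Q0] := eqVneq Q 0.
  move=> _; have /closed_rootP[w rw] : size (char_poly C) != 1%N by rewrite size_char_poly.
  by exists w => //; rewrite root0.
have [s QE] := closed_field_poly_normal Q.
rewrite QE linearZ /= detZ => /eqP; rewrite mulf_eq0 expf_eq0 lead_coef_eq0 (negbTE Q0) andbF /=.
rewrite rmorph_prod /= (big_morph _ (@det_mulmx K n.+1) (det1 _ _)).
rewrite prodf_seq_eq0 => /hasP[w ws]; rewrite /= hornerX eigen => rw; exists w => //.
by rewrite rootZ ?lead_coef_eq0 // root_prod_XsubC.
Qed.

End CompanionMatrices.

Lemma poly_eq0_of_values (K : numFieldType) (p : {poly K}) :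
  (forall x, x != 0 -> p.[x] = 0) -> p = 0.
Proof.
move=> h; apply/eqP; apply: contraT => p0.
pose s : seq K := [seq i.+1%:R | i <- iota 0 (size p)].
have : (size s < size p)%N.
  apply: max_poly_roots => //.
    by apply/allP => x /mapP[i _ ->]; rewrite rootE h // pnatr_eq0.
  rewrite map_inj_uniq ?iota_uniq // => i j /eqP.
  by rewrite eqr_nat eqSS => /eqP.
by rewrite size_map size_iota ltnn.
Qed.

Section CommonZero.
Variables (n : nat) (K : numClosedFieldType) (i0 i1 i2 : 'I_n).
Hypotheses (i02 : i0 != i2) (i12 : i1 != i2).
Implicit Types p : {mpoly K[n]}.

Definition point3 (x y w : K) : 'I_n -> K :=
  fun i => x *+ (i == i0) + y *+ (i == i1) + w *+ (i == i2).

(** Restriction to the line of direction [e_i2] through [x e_i0 + y e_i1]. The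
    coordinates [x] and [y] live in an extension [A] of [K], so that they can be
    numbers or polynomials in an auxiliary variable. *)
Definition slice (A : comNzRingType) (io : {rmorphism K -> A}) (x y : A) p : {poly A} :=
  mmap (polyC \o io) (fun i => (x *+ (i == i0) + y *+ (i == i1))%:P + 'X *+ (i == i2)) p.

Let sliceK x y p : {poly K} := slice idfun x y p.
Let sliceT x y p : {poly {poly K}} := slice polyC x y p.

Lemma slice_eval x y p t :
  map_poly (horner_eval t) (sliceT x y p) = sliceK x.[t] y.[t] p.
Proof.
rewrite /sliceT /sliceK /slice /mmap rmorph_sum; apply: eq_bigr => m _.
rewrite rmorphM /= map_polyC /= [horner_eval t _]hornerC; congr (_ * _).
rewrite /mmap1 rmorph_prod; apply: eq_bigr => i _; rewrite rmorphXn; congr (_ ^+ _).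
by rewrite rmorphD /= map_polyC /= rmorphMn /= map_polyX /horner_eval hornerD !hornerMn.
Qed.

Lemma slice_horner x y p w : (sliceK x y p).[w] = p.@[point3 x y w].
Proof.
rewrite /sliceK /slice /mmap horner_sum mevalE; apply: eq_bigr => m _.
rewrite hornerM hornerC; congr (_ * _); rewrite /mmap1 horner_prod.
apply: eq_bigr => i _; rewrite horner_exp; congr (_ ^+ _).
by rewrite hornerD hornerC hornerMn hornerX.
Qed.

Lemma slice_term x y (m : 'X_{1..n}) : exists c : K,
  mmap1 (fun i => (x *+ (i == i0) + y *+ (i == i1))%:P + 'X *+ (i == i2)) m
  = c *: 'X^(m i2) /\ (m i2 = mdeg m -> c = 1).
Proof.
exists (\prod_(i | i != i2) (x *+ (i == i0) + y *+ (i == i1)) ^+ m i); split.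
  rewrite /mmap1 (bigD1 i2) //= eqxx [i2 == i0]eq_sym (negbTE i02) [i2 == i1]eq_sym (negbTE i12).
  rewrite !mulr0n addr0 add0r mulr1n mulrC -mul_polyC; congr (_ * _).
  rewrite rmorph_prod; apply: eq_bigr => i /negbTE ->.
  by rewrite mulr0n addr0 rmorphXn.
rewrite mdegE (bigD1 i2) //= => /eqP; rewrite -[X in X == _]addn0 eqn_add2l eq_sym sum_nat_eq0.
move=> /forallP h; rewrite big1 // => i ii2; have := h i; rewrite ii2 => /eqP ->.
by rewrite expr0.
Qed.

Let pure_power d p m : p \is d.-homog -> m \in msupp p ->
  (forall i, i != i2 -> m i = 0%N) -> m = (U_(i2) *+ d)%MM.
Proof.
move=> hp mp m0; have md : mdeg m = d := dhomog_mf hp mp.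
apply/mnmP => i; rewrite mulmnE mnm1E; have [<-|ii2] := eqVneq i2 i; last first.
  by rewrite mul0n m0 // eq_sym.
by rewrite mul1n -md mdegE (bigD1 i2) //= big1 ?addn0.
Qed.

(** A monomial of degree [d] contributes to the coefficient [d] only if it
    involves no other variable than [X_i2]. *)
Lemma slice_homog d x y p : p \is d.-homog ->
  (size (sliceK x y p) <= d.+1)%N /\ (sliceK x y p)`_d = p@_(U_(i2) *+ d).
Proof.
move=> hp; have md m : m \in msupp p -> mdeg m = d by move=> mp; apply: (dhomog_mf hp mp).
have m2 m : m \in msupp p -> (m i2 <= d)%N.
  by move=> /md <-; rewrite mdegE (bigD1 i2) //= leq_addr.
split.
  apply/leq_sizeP => j aj; rewrite /sliceK /slice /mmap coef_sum big1_seq // => m /= /m2 ma.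
  have [c [-> _]] := slice_term x y m.
  by rewrite coefCM coefZ coefXn gtn_eqF ?mulr0 // (leq_ltn_trans ma).
have U2 : (U_(i2) *+ d)%MM i2 = d by rewrite mulmnE mnm1E eqxx mul1n.
have pureP m : m \in msupp p -> d = m i2 -> m = (U_(i2) *+ d)%MM.
  move=> mp e; apply: (pure_power hp mp) => i ii2.
  have /eqP := md m mp; rewrite mdegE (bigD1 i2) //= -e -[X in _ == X]addn0 eqn_add2l.
  by rewrite sum_nat_eq0 => /forallP/(_ i); rewrite ii2 => /eqP.
rewrite /sliceK /slice /mmap coef_sum.
have other m : m \in msupp p -> m != (U_(i2) *+ d)%MM ->
    ((polyC \o idfun) p@_m * mmap1 (fun i => (x *+ (i == i0) + y *+ (i == i1))%:P + 'X *+ (i == i2)) m)`_d = 0.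
  move=> mp mU; have [c [-> _]] := slice_term x y m; rewrite coefCM coefZ coefXn.
  by case: eqP => [/(pureP m mp) e|]; rewrite ?mulr0 //; rewrite e eqxx in mU.
have [us|us] := boolP ((U_(i2) *+ d)%MM \in msupp p); last first.
  rewrite (memN_msupp_eq0 us) big1_seq // => m /= mp; apply: other => //.
  by apply: contraNneq us => <-.
rewrite (bigD1_seq (U_(i2) *+ d)%MM) //= big1_seq ?addr0.
  have [c [-> c1]] := slice_term x y (U_(i2) *+ d)%MM.
  rewrite U2 coefCM coefZ coefXn eqxx c1 ?mulr1 ?mul1r //.
  by rewrite U2 mdegMn mdeg1 mul1n.
by move=> m /andP[mU mp]; apply: other.
Qed.

Section Monic.
Variables (d b : nat) (P Q : {mpoly K[n]}).
Hypotheses (hP : P \is d.+1.-homog) (hQ : Q \is b.+1.-homog).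
Let c := P@_(U_(i2) *+ d.+1).
Hypothesis c0 : c != 0.

(* The resultant with respect to the third coordinate of P and Q, as a polynomial
   along a curve (x, y) and as a number at a point (x, y). *)
Let D (x y : {poly K}) : {poly K} :=
  \det (horner_mx (companion d.+1 (fun j => c^-1 *: (sliceT x y P)`_j)) (sliceT x y Q)).
Let DK (x y : K) : K :=
  \det (horner_mx (companion d.+1 (fun j => (c^-1 *: sliceK x y P)`_j)) (sliceK x y Q)).

Let D_eval x y t : (D x y).[t] = DK x.[t] y.[t].
Proof.
rewrite -[LHS]/(horner_eval t _) -det_map_mx map_horner_mx slice_eval; congr (\det (horner_mx _ _)).
apply/matrixP => i j; rewrite !mxE; case: ifP => _; last by rewrite rmorph_nat.
rewrite rmorphN /= /horner_eval hornerZ coefZ; congr (- (_ * _)).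
by rewrite -slice_eval coef_map.
Qed.

Let DK_zero x y : DK x y = 0 <->
  exists2 w, P.@[point3 x y w] = 0 & Q.@[point3 x y w] = 0.
Proof.
have [sz lc] := slice_homog x y hP.
have sz2 : size (sliceK x y P) = d.+2.
  apply/eqP; rewrite eqn_leq sz /= ltnNge; apply/negP => /leq_sizeP/(_ d.+1 (leqnn _)).
  by rewrite lc => /eqP; rewrite (negbTE c0).
have ch : char_poly (companion d.+1 (fun j => (c^-1 *: sliceK x y P)`_j)) = c^-1 *: sliceK x y P.
  apply: char_poly_companion; last by rewrite size_scale ?invr_eq0 // sz2.
  by rewrite monicE lead_coefZ lead_coefE sz2 /= lc mulVf.
have rP w : root (c^-1 *: sliceK x y P) w = (P.@[point3 x y w] == 0).
  by rewrite rootZ ?invr_eq0 // rootE slice_horner.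
have rQ w : root (sliceK x y Q) w = (Q.@[point3 x y w] == 0).
  by rewrite rootE slice_horner.
rewrite /DK horner_mx_singularP ch; split=> -[w].
  by rewrite rP rQ => /eqP Pw /eqP Qw; exists w.
by move=> Pw Qw; exists w; rewrite ?rP ?rQ ?Pw ?Qw.
Qed.

Let elimination : exists (E : {poly K} -> {poly K} -> {poly K}) (EK : K -> K -> K),
  (forall x y t, (E x y).[t] = EK x.[t] y.[t]) /\
  forall x y, EK x y = 0 <-> exists2 w, P.@[point3 x y w] = 0 & Q.@[point3 x y w] = 0.
Proof. by exists D, DK. Qed.

(** Bezout's theorem in its weakest form. The resultant [E(x, y)] vanishes at the
    origin, where both restrictions are multiples of powers of the third
    coordinate. If it vanished nowhere else, then for [x != 0] the polynomial
    [E(x, -)] would have no root, hence be constant; so [E(x, 1) = E(x, 0)] for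
    all [x != 0], hence for [x = 0] too, and [E(0, 1) = E(0, 0) = 0] after all. *)
Lemma common_zero_monic : exists x y w : K, (x, y, w) != (0, 0, 0) /\
  P.@[point3 x y w] = 0 /\ Q.@[point3 x y w] = 0.
Proof.
have [E [EK [E_eval EK_zero]]] := elimination.
apply: contrapT => none.
have DK0 x y : (x != 0) || (y != 0) -> EK x y != 0.
  move=> xy; apply/eqP => /EK_zero[w Pw Qw]; apply: none; exists x, y, w; split=> //.
  by rewrite !xpair_eqE !negb_and xy.
have D00 : EK 0 0 = 0.
  have homog0 e (p : {mpoly K[n]}) : p \is e.+1.-homog -> p.@[point3 0 0 0] = 0.
    move=> hp; rewrite mevalE big1_seq // => m /= mp.
    have me : mdeg m = e.+1 := dhomog_mf hp mp; rewrite mdegE in me.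
    have /existsP[i mi] : [exists i, m i != 0%N].
      apply: contraT; rewrite negb_exists => /forallP h.
      by move: me; rewrite big1 // => i _; have := h i; rewrite negbK => /eqP.
    rewrite (bigD1 i) //= /point3 !mul0rn !addr0 expr0n (negbTE mi) mul0r mulr0 //.
  by apply/EK_zero; exists 0; [apply: homog0 hP | apply: homog0 hQ].
have const x : x != 0 -> EK x 0 = EK x 1.
  move=> x0; have /eqP/size_poly1P[k _ Dk] : size (E x%:P 'X) = 1%N.
    apply/eqP; apply: contraT => /closed_rootP[t]; rewrite rootE E_eval hornerC hornerX.
    by rewrite (negbTE (DK0 _ _ _)) // x0.
  have := E_eval x%:P 'X 0; have := E_eval x%:P 'X 1.
  by rewrite !hornerC !hornerX Dk !hornerC => <- <-.
have D01 : E 'X 1 - E 'X 0 = 0.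
  apply: poly_eq0_of_values => x x0; rewrite hornerD hornerN !E_eval hornerX.
  by rewrite (hornerC 1) horner0 const // subrr.
have := congr1 (fun r : {poly K} => r.[0]) D01; rewrite hornerD hornerN !E_eval hornerX !(hornerC 1) !horner0 D00 subr0.
by move=> /eqP; rewrite (negbTE (DK0 _ _ _)) // oner_eq0 orbT.
Qed.

End Monic.

(** If neither form is monic in the third coordinate, then both vanish at [e_i2]. *)
Lemma common_zero d b (P Q : {mpoly K[n]}) :
  P \is d.+1.-homog -> Q \is b.+1.-homog ->
  exists x y w : K, (x, y, w) != (0, 0, 0) /\ P.@[point3 x y w] = 0 /\ Q.@[point3 x y w] = 0.
Proof.
move=> hP hQ.
have [P0|P0] := eqVneq (P@_(U_(i2) *+ d.+1)) 0; last exact: (common_zero_monic hP hQ P0).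
have [Q0|Q0] := eqVneq (Q@_(U_(i2) *+ b.+1)) 0; last first.
  by have [x [y [w [h1 [h2 h3]]]]] := common_zero_monic hQ hP Q0; exists x, y, w.
exists 0, 0, 1; split; first by rewrite xpair_eqE oner_eq0 andbF.
have ev e (p : {mpoly K[n]}) : p \is e.-homog -> p@_(U_(i2) *+ e) = 0 -> p.@[point3 0 0 1] = 0.
  move=> hp pU; rewrite mevalE big1_seq // => m /= mp.
  have [/existsP[i /andP[ii2 mi]]|] := boolP [exists i, (i != i2) && (m i != 0%N)].
    rewrite (bigD1 i) //= /point3 !mul0rn !add0r (negbTE ii2) mulr0n expr0n (negbTE mi).
    by rewrite mul0r mulr0.
  rewrite negb_exists => /forallP h; suff mE : m = (U_(i2) *+ e)%MM.
    by move: mp; rewrite mE -[_ \in _]negbK -mcoeff_eq0 pU eqxx.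
  apply: (pure_power hp mp) => i ii2; have := h i.
  by rewrite ii2 /= negbK => /eqP.
by rewrite !(ev _ _ hP, ev _ _ hQ).
Qed.

End CommonZero.

Section Irreducibility.
Variables (N q e : nat) (K : numClosedFieldType) (a : 'rV[K]_q.+1).
Hypotheses (e_gt1 : (1 < e)%N) (qN : (q <= N)%N) (a_neq0 : forall j, a 0 j != 0).
Hypothesis N_ge3 : (3 <= N)%N.

Let F := normal_form N.+1 e.+1 a.

Lemma normal_form_homog : F \is e.+1.-homog.
Proof.
have pow (p : {mpoly K[N.+1]}) : p \is 1.-homog -> p ^+ e.+1 \is e.+1.-homog.
  by move=> hp; have := dhomogMn e.+1 hp; rewrite mul1n.
have var i : ('X_i : {mpoly K[N.+1]}) \is 1.-homog by rewrite dhomogX /= mdeg1.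
rewrite /F normal_formE; apply: rpredD; first by apply: rpred_sum => i _; apply: pow.
by apply: pow; apply: rpred_sum => i _; apply: rpredZ.
Qed.

Lemma normal_form_smooth_off_axis (p : 'rV[K]_N.+1) :
  p 0 0 = 0 -> ~ singular_point F p.
Proof.
by move=> p0 /(singular_support e_gt1 a_neq0)[_ /(_ 0 isT)]; rewrite p0 eqxx.
Qed.

Lemma normal_form_neq0 : F != 0.
Proof.
apply/eqP => F0; pose p : 'rV[K]_N.+1 := \row_i (i != 0)%:R.
apply: (@normal_form_smooth_off_axis p); first by rewrite mxE.
rewrite F0; split=> [||i]; rewrite ?mderiv0 ?meval0 //.
apply/eqP => /rowP/(_ ord_max); rewrite !mxE.
have -> : (ord_max : 'I_N.+1) != 0 by rewrite -val_eqE /= -lt0n (leq_trans _ N_ge3).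
by move=> /eqP; rewrite oner_eq0.
Qed.

(** A singular point has no vanishing coordinate among the first [q + 1]. Two
    factors of positive degree would be homogeneous and have a common zero on
    the coordinate plane spanned by the second, third and fourth basis vectors;
    the product would be singular there, although the first coordinate is 0. *)
Lemma normal_form_irreducible : irreducible_mpoly F.
Proof.
have size_homog d (p : {mpoly K[N.+1]}) : p != 0 -> p \is d.-homog -> msize p = d.+1.
  move=> p0 hp; rewrite mpolySpred //; congr _.+1.
  exact: dhomog_uniq p0 (dhomog_msize hp) hp.
split; first by rewrite (size_homog e.+1) ?normal_form_neq0 ?normal_form_homog.
move=> g h Fgh; have F0 := normal_form_neq0; have hF := normal_form_homog.
rewrite Fgh in F0 hF.
have [k hg] := homogeneous_factor hF F0.
have [hF' F0'] : h * g \is e.+1.-homog /\ h * g != 0 by rewrite mulrC.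
have [l hh] := homogeneous_factor hF' F0'.
have /andP[g0 h0] : (g != 0) && (h != 0) by rewrite -negb_or -mulf_eq0.
case: k hg => [|k] hg; first by left; rewrite (size_homog _ _ g0 hg).
case: l hh => [|l] hh; first by right; rewrite (size_homog _ _ h0 hh).
have lt i : (i < 3)%N -> (i.+1 < N.+1)%N by move=> i3; rewrite ltnS (leq_trans i3).
pose i0 := Ordinal (lt 0%N isT); pose i1 := Ordinal (lt 1%N isT); pose i2 := Ordinal (lt 2%N isT).
have [i02 i12] : i0 != i2 /\ i1 != i2 by rewrite -!val_eqE.
have [x [y [w [nz [gz hz]]]]] := common_zero i02 i12 hg hh.
pose p : 'rV[K]_N.+1 := \row_i point3 i0 i1 i2 x y w i.
have pE i : p 0 i = point3 i0 i1 i2 x y w i by rewrite mxE.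
have gp : g.@[p 0] = 0 by rewrite -gz; apply: meval_eq.
have hp : h.@[p 0] = 0 by rewrite -hz; apply: meval_eq.
exfalso; apply: (@normal_form_smooth_off_axis p).
  by rewrite pE /point3 -!val_eqE /= !mulr0n !addr0.
rewrite Fgh; split.
- apply: contraNneq nz => /rowP p0.
  have := p0 i0; have := p0 i1; have := p0 i2.
  by rewrite !pE !mxE /point3 -!val_eqE /= !mulr0n !mulr1n ?addr0 ?add0r => -> -> ->.
- by rewrite mevalM gp mul0r.
by move=> i; rewrite mderivM mevalD !mevalM gp hp mulr0 mul0r addr0.
Qed.

End Irreducibility.

(** * Existence of the normal form *)

Section Substitution.
Variables (n : nat) (K : numFieldType).
Implicit Types (A B : 'M[K]_n) (l : 'rV[K]_n).

Lemma linear_form_delta i : linear_form (delta_mx 0 i : 'rV[K]_n) = 'X_i.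
Proof.
rewrite /linear_form (bigD1 i) //= mxE !eqxx scale1r big1 ?addr0 // => j /negbTE ji.
by rewrite mxE ji andbF scale0r.
Qed.

Lemma linear_formD l l' : linear_form (l + l') = linear_form l + linear_form l'.
Proof. by rewrite -big_split; apply: eq_bigr => j _; rewrite mxE scalerDl. Qed.

Lemma linear_formZ c l : linear_form (c *: l) = c *: linear_form l.
Proof. by rewrite scaler_sumr; apply: eq_bigr => j _; rewrite mxE scalerA. Qed.

Lemma linear_form0 : linear_form (0 : 'rV[K]_n) = 0.
Proof. by rewrite /linear_form big1 // => j _; rewrite mxE scale0r. Qed.

Lemma linear_form_sum I r (P : pred I) (l : I -> 'rV[K]_n) :
  linear_form (\sum_(i <- r | P i) l i) = \sum_(i <- r | P i) linear_form (l i).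
Proof. exact: (big_morph _ linear_formD linear_form0). Qed.

Lemma linear_subst_form A l : linear_subst A (linear_form l) = linear_form (l *m A).
Proof.
rewrite /linear_subst raddf_sum mulmx_sum_row linear_form_sum.
apply: eq_bigr => j _; rewrite /= comp_mpolyZ comp_mpolyXU -tnth_nth tnth_mktuple.
by rewrite linear_formZ.
Qed.

Lemma linear_subst_powers A d r (l : 'I_r -> 'rV[K]_n) :
  linear_subst A (\sum_i linear_form (l i) ^+ d) = \sum_i linear_form (l i *m A) ^+ d.
Proof.
rewrite {1}/linear_subst raddf_sum; apply: eq_bigr => i _.
by rewrite /= rmorphXn /= -linear_subst_form.
Qed.

Lemma linear_subst_bordered A d (b : 'rV[K]_n) :
  linear_subst A (bordered_fermat d b) =
  \sum_i linear_form (row i A) ^+ d + linear_form (b *m A) ^+ d.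
Proof.
rewrite /bordered_fermat {1}/linear_subst comp_mpolyD; congr (_ + _).
  rewrite raddf_sum; apply: eq_bigr => i _.
  by rewrite /= rmorphXn /= -linear_form_delta -/(linear_subst A _) linear_subst_form -rowE.
by rewrite /= rmorphXn /= -linear_subst_form.
Qed.

End Substitution.

Section WaringForms.
Variables (n d : nat) (K : numFieldType) (f : {mpoly K[n]}).
Hypothesis f_essential : essentially_involves_all f.

(** If the linear forms did not span, a linear change of coordinates would make
    their last coefficients vanish, and the last variable would disappear. *)
Lemma essential_row_full r (l : 'I_r -> 'rV[K]_n) :
  f = \sum_i linear_form (l i) ^+ d -> row_full (\matrix_i l i).
Proof.
set M := \matrix_i l i => fE; rewrite /row_full eqn_leq rank_leq_col /=.
rewrite leqNgt; apply/negP => rkM.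
have n_gt0 : (0 < n)%N := leq_ltn_trans (leq0n _) rkM.
have i0P : (n.-1 < n)%N by rewrite prednK.
pose i0 := Ordinal i0P; pose A := invmx (row_ebase M).
have Au : A \in unitmx by rewrite unitmx_inv row_ebase_unit.
have MA i : (l i *m A) 0 i0 = 0.
  have -> : l i = row i M by rewrite rowK.
  have {1}-> : M = col_ebase M *m pid_mx (\rank M) *m row_ebase M by rewrite mulmx_ebase.
  rewrite -!row_mul mulmxK ?row_ebase_unit // !mxE big1 // => k _.
  rewrite !mxE; case: eqP => [->|]; rewrite ?mulr0 //=.
  by rewrite ltnNge -ltnS prednK // rkM mulr0.
have [a] := f_essential Au i0; rewrite fE linear_subst_powers => amem ai0.
set g := \sum_i _ in amem.
have dg : g^`M(i0) = 0.
  rewrite raddf_sum big1 // => i _; case: (d) => [|d'] /=.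
    by rewrite expr0 -mpolyC1 mderivC.
  by rewrite mderiv_exp mderiv_linear_form MA mulr0 scaler0.
have := mcoeff_deriv i0 (a - U_(i0))%MM g.
rewrite dg mcoeff0 submK; last first.
  by apply/mnm_lepP => j; rewrite mnm1E; case: eqP => [<-|] //; rewrite lt0n.
by move=> /esym/eqP; rewrite mulrn_eq0 /= mcoeff_eq0 amem.
Qed.

Lemma essential_powers_ge r : sum_of_powers d f r -> (n <= r)%N.
Proof.
by move=> [l /essential_row_full/eqP <-]; apply: rank_leq_row.
Qed.

End WaringForms.

Lemma sort_support (n : nat) (P : pred 'I_n) :
  exists s : 'S_n, forall i : 'I_n, P (s i) = (i < #|P|)%N.
Proof.
pose t := enum P ++ enum (predC P).
have st : size t = n by rewrite size_cat -!cardE cardC card_ord.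
have ut : uniq t.
  rewrite cat_uniq !enum_uniq andbT; apply/hasPn => i /=.
  by rewrite !mem_enum inE.
have inj : injective (fun i : 'I_n => nth i t i).
  move=> i j; rewrite (set_nth_default j) ?st // => /eqP.
  by rewrite nth_uniq ?st // => /eqP/val_inj.
exists (perm inj) => i; rewrite permE nth_cat -cardE.
case: ltnP => ic; last first.
  apply/negbTE; suff : nth i (enum (predC P)) (i - #|P|) \in enum (predC P) by rewrite mem_enum.
  by apply: mem_nth; rewrite -cardE ltn_subLR // cardC card_ord.
suff : nth i (enum P) i \in enum P by rewrite mem_enum.
by apply: mem_nth; rewrite -cardE.
Qed.

Section Existence.
Variables (n d : nat) (K : numClosedFieldType) (f : {mpoly K[n]}).
Hypothesis n_ge3 : (3 <= n)%N.
Hypothesis f_essential : essentially_involves_all f.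
Hypothesis f_rank : waring_rank d f n.+1.

(** Of the [n + 1] forms of a minimal decomposition, [n] are a basis: they become
    the coordinates, ordered so that those that occur in the last form come
    first. *)
Lemma bordered_form_exists : exists2 A : 'M[K]_n, A \in unitmx &
  exists2 b : 'rV[K]_n, linear_subst A f = bordered_fermat d b &
  exists2 k, (k <= n)%N & forall i : 'I_n, (b 0 i != 0) = (i < k)%N.
Proof.
have [[l fE] _] := f_rank; have full := essential_row_full f_essential fE.
pose M := \matrix_i l i; pose g := fullrankfun full.
have g_inj : injective g by apply: fullrankfun_inj.
pose B := rowsub g M; have Bu : B \in unitmx by apply: fullrowsub_unit.
have [j0 j0P] : exists j0, ~: (g @: setT) = [set j0].
  apply/cards1P; rewrite cardsCs setCK card_imset // cardsT !card_ord.
  by rewrite subSn // subnn.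
pose b0 := l j0 *m invmx B.
have [s sP] := sort_support (fun i => b0 0 i != 0).
pose A := invmx B *m perm_mx s^-1.
exists A; first by rewrite unitmx_mul unitmx_inv Bu unitmx_perm.
have rowA i : l (g i) *m A = delta_mx 0 (s^-1 i)%g.
  have -> : l (g i) = row i B by rewrite row_rowsub rowK.
  rewrite mulmxA -row_mul mulmxV // rowE mulmx1 -rowE.
  by apply/rowP => j; rewrite !mxE eqxx eq_sym.
exists (l j0 *m A).
  rewrite fE linear_subst_powers (bigID (mem (g @: setT))) /= big_imset /=; last first.
    by move=> i i' _ _; apply: g_inj.
  rewrite /bordered_fermat; congr (_ + _).
    rewrite [RHS](reindex_inj (@perm_inj _ s^-1)) /=.
    by apply: eq_big => [i|i _]; rewrite ?inE // rowA linear_form_delta.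
  rewrite (big_pred1 j0) // => j.
  by have /setP/(_ j) := j0P; rewrite !inE.
exists #|(fun i => b0 0 i != 0)| => [|i]; first by rewrite -[X in (_ <= X)%N]card_ord max_card.
rewrite -sP.
by rewrite mulmxA -/b0 -col_permE mxE.
Qed.

(** Any decomposition of the bordered form can be carried back to [f]. *)
Lemma bordered_rank A (b : 'rV[K]_n) s (l : 'I_s -> 'rV[K]_n) : A \in unitmx ->
  linear_subst A f = bordered_fermat d b ->
  bordered_fermat d b = \sum_i linear_form (l i) ^+ d -> (n < s)%N.
Proof.
move=> Au fA bE; have [[l' fE] min] := f_rank; apply: min.
exists (fun i => l i *m invmx A); rewrite -linear_subst_powers -bE -fA fE.
rewrite linear_subst_powers linear_subst_powers; apply: eq_bigr => i _.
by rewrite mulmxK.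
Qed.

(** In degree at most 1 the form involves at most one linear form, hence not all
    the variables. In degree 2 the bordered form has Gram matrix [1 + b^T b],
    which is a square, so that [n] squares suffice. *)
Lemma waring_degree_ge3 : (3 <= d)%N.
Proof.
have [[l fE] _] := f_rank.
rewrite ltnNge; apply/negP => d2; have : [|| d == 0, d == 1 | d == 2]%N.
  by case: (d) d2 => [|[|[|]]].
case/or3P => /eqP dE.
- have /(essential_row_full f_essential) : f = \sum_(i < n.+1) linear_form (0 : 'rV[K]_n) ^+ d.
    by rewrite fE dE.
  have -> : \matrix_(i < n.+1) (0 : 'rV[K]_n) = 0 by apply/matrixP => i j; rewrite !mxE.
  by rewrite /row_full mxrank0 => /eqP n0; move: n_ge3; rewrite -n0.
- suff /(essential_powers_ge f_essential) : sum_of_powers d f 1.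
    by rewrite leqNgt (leq_trans _ n_ge3).
  exists (fun=> \sum_i l i); rewrite big_ord1 dE expr1 linear_form_sum fE dE.
  by apply: eq_bigr => i _; rewrite expr1.
have [A Au [b fA _]] := bordered_form_exists.
have [c cE] := rank_one_square_root (\sum_i b 0 i ^+ 2).
suff /(bordered_rank Au fA) : bordered_fermat d b =
    \sum_i linear_form (delta_mx 0 i + (c * b 0 i) *: b) ^+ d by rewrite ltnn.
rewrite dE /bordered_fermat; set L := linear_form b.
have LE : L = \sum_i b 0 i *: 'X_i by [].
have -> : \sum_i linear_form (delta_mx 0 i + (c * b 0 i) *: b) ^+ 2 =
    \sum_i ('X_i ^+ 2 + (2 * c) *: (L * (b 0 i *: 'X_i)) + (c ^+ 2 * b 0 i ^+ 2) *: L ^+ 2).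
  apply: eq_bigr => i _; rewrite linear_formD linear_form_delta linear_formZ -/L.
  by rewrite -!mul_mpolyC !(mpolyCM, rmorphXn) /= mpolyC_nat; ring.
rewrite !big_split /= -scaler_sumr -mulr_sumr -LE -scaler_suml -mulr_sumr -expr2 -addrA.
congr (_ + _); rewrite -scalerDl -[LHS]scale1r; congr (_ *: _).
move/eqP: cE; rewrite subr_eq0 => /eqP cE; rewrite -[LHS]cE; ring.
Qed.

(** If the last form involved at most one variable, its power could be merged with
    that of the variable, and the rank would be at most [n]. *)
Lemma normal_form_exists : exists k, (2 <= k <= n)%N /\
  exists (A : 'M[K]_n) (a : 'rV[K]_k.-1.+1), has_normal_form d f A a.
Proof.
have d_gt0 : (0 < d)%N := ltnW (ltnW waring_degree_ge3).
have [A Au [b fA [k kn bk]]] := bordered_form_exists.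
exists k; have k2 : (2 <= k)%N.
  rewrite leqNgt; apply/negP => k1.
  have n_gt0 : (0 < n)%N by apply: leq_trans n_ge3.
  pose i0 := Ordinal n_gt0.
  have b0 i : i != i0 -> b 0 i = 0.
    move=> ii0; apply/eqP; rewrite -[_ == _]negbK bk -leqNgt.
    by apply: (leq_trans (k1 : (k <= 1)%N)); rewrite lt0n.
  pose c i := if i == i0 then d.-root (1 + b 0 i0 ^+ d) else 1.
  suff /(bordered_rank Au fA) : bordered_fermat d b =
    \sum_i linear_form (c i *: delta_mx 0 i) ^+ d by rewrite ltnn.
  have -> : \sum_i linear_form (c i *: delta_mx 0 i) ^+ d = \sum_i (c i ^+ d) *: 'X_i ^+ d.
    by apply: eq_bigr => i _; rewrite linear_formZ linear_form_delta exprZn.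
  have LE : linear_form b = b 0 i0 *: 'X_i0.
    by rewrite /linear_form (bigD1 i0) //= big1 ?addr0 // => i /b0 ->; rewrite scale0r.
  rewrite /bordered_fermat LE (bigD1 i0) //= [RHS](bigD1 i0) //= /c eqxx rootCK //.
  rewrite exprZn scalerDl scale1r addrAC; congr (_ + _).
  by apply: eq_bigr => i /negbTE ->; rewrite expr1n scale1r.
split; first by rewrite k2.
have k_gt0 : (0 < k)%N by apply: ltnW.
pose a : 'rV[K]_k.-1.+1 := \row_j oapp (b 0) 0 (insub (j : nat)).
exists A, a; split=> // [j|].
  have jk : (j < k)%N by rewrite -{2}(prednK k_gt0).
  by rewrite mxE (insubT (fun i => (i < n)%N) (leq_trans jk kn)) /= bk.
rewrite fA normal_formE; congr (bordered_fermat _ _).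
apply/rowP => i; rewrite mxE; case: ifP => ik.
  by rewrite mxE inordK ?ltnS // valK.
by apply/eqP; rewrite -[_ == _]negbK bk -leqNgt -(prednK k_gt0) ltnNge ik.
Qed.

End Existence.

(** * Uniqueness of the number of variables of the extra form *)

Section HessianCenter.
Variables (n e : nat) (K : numFieldType).
Hypothesis e_gt0 : (0 < e)%N.
Implicit Types (b y : 'rV[K]_n) (X : 'M[K]_n).

(** The Hessian matrix at [y] of the bordered form of degree [e + 2], divided by
    [(e + 2) (e + 1)]. *)
Definition hessian_form b y : 'M[K]_n :=
  diag_mx (\row_i y 0 i ^+ e) + (\sum_i b 0 i * y 0 i) ^+ e *: (b^T *m b).

(** The center of a form is the algebra of the endomorphisms that are self-adjoint
    for its Hessian at every point; it is conjugated by a linear change of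
    coordinates, and a direct sum decomposition of the form shows up in it as
    idempotents. *)
Definition in_center b X := forall y, hessian_form b y *m X = X^T *m hessian_form b y.

Lemma outer_productE b i j : (b^T *m b) i j = b 0 i * b 0 j.
Proof. by rewrite mxE big_ord1 mxE. Qed.

Lemma hessian_formE b y i j : hessian_form b y i j =
  (y 0 i ^+ e) *+ (i == j) + (\sum_i b 0 i * y 0 i) ^+ e * (b 0 i * b 0 j).
Proof. by rewrite [LHS]mxE [X in X + _]mxE [X in _ + X]mxE outer_productE mxE. Qed.

(** With three variables in the extra form there is, for [i != j], a point where
    it vanishes while [y_i = 1] and [y_j = 0]; the Hessian is diagonal there. *)
Lemma center_off_diagonal b k X : (forall i : 'I_n, (b 0 i != 0) = (i < k)%N) ->
  (3 <= k)%N -> (k <= n)%N -> in_center b X -> forall i j, i != j -> X i j = 0.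
Proof.
move=> bk k3 kn cX i j ij.
have [l [lk li lj]] : exists l : 'I_n, [/\ (l < k)%N, l != i & l != j].
  have lt t : (t < 3)%N -> (t < n)%N by move=> h; apply: leq_trans (leq_trans h k3) kn.
  pose l0 := Ordinal (lt 0%N isT); pose l1 := Ordinal (lt 1%N isT); pose l2 := Ordinal (lt 2%N isT).
  case: (altP (l0 =P i)) => [e0|n0].
    case: (altP (l1 =P j)) => [e1|n1].
      by exists l2; split; rewrite -?e0 -?e1 //; apply: leq_trans k3.
    by exists l1; split; rewrite -?e0 //; apply: leq_trans k3.
  case: (altP (l0 =P j)) => [e0|n0']; last by exists l0; split=> //; apply: leq_trans k3.
  case: (altP (l1 =P i)) => [e1|n1].
    by exists l2; split; rewrite -?e0 -?e1 //; apply: leq_trans k3.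
  by exists l1; split; rewrite -?e0 //; apply: leq_trans k3.
have bl : b 0 l != 0 by rewrite bk.
pose y : 'rV[K]_n := \row_t (if t == i then 1 else if t == l then - (b 0 i / b 0 l) else 0).
have yi : y 0 i = 1 by rewrite mxE eqxx.
have yj : y 0 j = 0 by rewrite mxE eq_sym (negbTE ij) eq_sym (negbTE lj).
have Ly : \sum_t b 0 t * y 0 t = 0.
  rewrite (bigD1 i) //= yi mulr1 (bigD1 l) //= mxE (negbTE li) eqxx mulrN mulrCA divff // mulr1.
  rewrite big1 ?addr0 ?subrr // => t /andP[/negbTE ti /negbTE tl].
  by rewrite mxE ti tl mulr0.
have HE u v : hessian_form b y u v = (y 0 u ^+ e) *+ (u == v).
  by rewrite hessian_formE Ly expr0n gtn_eqF // mul0r addr0.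
have /matrixP/(_ i j) := cX y; rewrite !mxE.
rewrite (bigD1 i) //= HE eqxx yi expr1n mul1r big1 ?addr0; last first.
  by move=> t ti; rewrite HE eq_sym (negbTE ti) mul0r.
move=> ->; rewrite big1 // => t _; rewrite HE; case: eqP => [->|_]; last by rewrite mulr0.
by rewrite yj expr0n gtn_eqF // mul0rn mulr0.
Qed.

(** Where the extra form takes the value 1, the entry [(i, j)] of the Hessian,
    for [i != j], is [b_i b_j], which is nonzero. *)
Lemma center_diagonal b k X : (forall i : 'I_n, (b 0 i != 0) = (i < k)%N) ->
  (3 <= k)%N -> (k <= n)%N -> in_center b X ->
  forall i j : 'I_n, (i < k)%N -> (j < k)%N -> X i i = X j j.
Proof.
move=> bk k3 kn cX i j ik jk; have [->//|ij] := eqVneq i j.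
have X0 := center_off_diagonal bk k3 kn cX.
have bi : b 0 i != 0 by rewrite bk.
have bj : b 0 j != 0 by rewrite bk.
pose y : 'rV[K]_n := (b 0 i)^-1 *: delta_mx 0 i.
have Ly : \sum_t b 0 t * y 0 t = 1.
  rewrite (bigD1 i) //= !mxE !eqxx mulr1 divff // big1 ?addr0 // => t ti.
  by rewrite !mxE (negbTE ti) andbF !mulr0.
have Hij : hessian_form b y i j = b 0 i * b 0 j.
  by rewrite hessian_formE (negbTE ij) mulr0n add0r Ly expr1n mul1r.
have /matrixP/(_ i j) := cX y; rewrite !mxE (bigD1 j) //= [X in _ + X]big1 ?addr0; last first.
  by move=> t tj; rewrite X0 ?mulr0.
rewrite Hij (bigD1 i) //= [X in _ = _ + X]big1 ?addr0; last first.
  by move=> t ti; rewrite mxE X0 ?mul0r.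
by rewrite mxE Hij mulrC => /mulIf -> //; rewrite mulf_neq0.
Qed.

Lemma center_contains b k (c : nat -> K) :
  (forall i : 'I_n, (b 0 i != 0) = (i < k)%N) ->
  (forall i j, (i < k)%N -> (j < k)%N -> c i = c j) ->
  in_center b (diag_mx (\row_i c i)).
Proof.
move=> bk cE y; rewrite tr_diag_mx; apply/matrixP => i j.
rewrite mul_mx_diag mul_diag_mx !mxE -/(hessian_form b y).
rewrite mulrC; case: (altP (i =P j)) => [->//|ij].
rewrite mulr0n !add0r big_ord1 !mxE.
have [->|bi] := eqVneq (b 0 i) 0; first by rewrite mul0r !mulr0.
have [->|bj] := eqVneq (b 0 j) 0; first by rewrite !mulr0.
by rewrite (cE i j) // -bk.
Qed.

Lemma center_conj b b' B X : B \in unitmx ->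
  (forall y, B^T *m hessian_form b (y *m B^T) *m B = hessian_form b' y) ->
  in_center b X -> in_center b' (invmx B *m X *m B).
Proof.
move=> Bu hB cX y; rewrite -hB !trmx_mul trmx_inv !mulmxA.
rewrite mulmxK // mulmxKV ?unitmx_tr //.
by rewrite -(mulmxA B^T _ X) cX !mulmxA.
Qed.

(** The center of the first form contains a diagonal matrix with [n - k + 1]
    distinct entries. Its conjugate lies in the center of the second form, hence
    is diagonal with at most [n - k' + 1] distinct entries, and these contain all
    the eigenvalues. *)
Lemma center_comparison b b' k k' B : B \in unitmx ->
  (forall i : 'I_n, (b 0 i != 0) = (i < k)%N) ->
  (forall i : 'I_n, (b' 0 i != 0) = (i < k')%N) ->
  (forall y, B^T *m hessian_form b (y *m B^T) *m B = hessian_form b' y) ->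
  (0 < k)%N -> (3 <= k')%N -> (k <= n)%N -> (k' <= n)%N -> (k' <= k)%N.
Proof.
move=> Bu bk bk' hB k0 k3 kn kn'.
pose c (i : nat) : K := (if (i < k)%N then 0 else i)%:R.
pose X := diag_mx (\row_(i < n) c i).
have cX : in_center b X.
  by apply: center_contains bk _ => i j ik jk; rewrite /c ik jk.
pose X' := invmx B *m X *m B.
have cX' : in_center b' X' := center_conj Bu hB cX.
have off := center_off_diagonal bk' k3 kn' cX'.
have dia := center_diagonal bk' k3 kn' cX'.
have BX : B *m X' = X *m B by rewrite /X' !mulmxA mulmxV // mul1mx.
have value (i : 'I_n) : exists j, X' j j = c i.
  have [j Bij] : exists j, B i j != 0.
    apply/existsP; apply: contraT; rewrite negb_exists => /forallP h.
    have r0 : row i B = 0 by apply/rowP => j; rewrite !mxE; have := h j; rewrite negbK => /eqP.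
    have : row i (1%:M : 'M[K]_n) 0 i = 0.
      by rewrite -(mulmxV Bu) row_mul r0 mul0mx mxE.
    by rewrite !mxE eqxx => /eqP; rewrite oner_eq0.
  exists j; have := congr1 (fun M : 'M[K]_n => M i j) BX.
  rewrite mul_diag_mx [LHS]mxE [RHS]mxE [X in _ = X * _]mxE (bigD1 j) //= big1 ?addr0.
    by rewrite mulrC => /(mulIf Bij).
  by move=> t tj; rewrite off ?mulr0.
have n0 : (0 < n)%N by apply: leq_trans kn.
pose x' (j : nat) : K := if insub j is Some i then X' i i else 0.
have x'E (j : 'I_n) : x' j = X' j j by rewrite /x' valK.
pose S : seq K := 0 :: [seq i%:R | i <- iota k (n - k)].
pose S' : seq K := x' 0%N :: [seq x' i | i <- iota k' (n - k')].
have SS' : {subset S <= S'}.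
  have valS i : (i < n)%N -> c i \in S'.
    move=> i_n; have [j jE] := value (Ordinal i_n); rewrite -[c i]jE -x'E.
    have [jk|jk] := ltnP j k'; last first.
      by rewrite inE map_f ?orbT // mem_iota jk subnKC // ltn_ord.
    have x'0 : x' 0%N = X' (Ordinal n0) (Ordinal n0) := x'E (Ordinal n0).
    rewrite inE x'E x'0 (dia j (Ordinal n0)) ?eqxx //.
    exact: leq_trans k3.
  apply/allP; rewrite /= all_map; apply/andP; split.
    by have := valS 0%N n0; rewrite /c k0.
  apply/allP => i; rewrite mem_iota subnKC // => /andP[ki i_n] /=.
  by have := valS i i_n; rewrite /c ltnNge ki.
have uS : uniq S.
  rewrite /= map_inj_uniq ?iota_uniq ?andbT; last by move=> i j /eqP; rewrite eqr_nat => /eqP.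
  apply/mapP; case=> i; rewrite mem_iota => /andP[ki _] /esym/eqP.
  by rewrite pnatr_eq0 => /eqP i0; move: ki; rewrite i0 leqNgt k0.
have := uniq_leq_size uS SS'; rewrite /= !size_map !size_iota ltnS.
by rewrite leq_sub2lE.
Qed.

End HessianCenter.

Section Uniqueness.
Variables (n e : nat) (K : numFieldType) (f : {mpoly K[n]}).
Hypothesis e_gt0 : (0 < e)%N.

Lemma second_derivative (C : 'M[K]_n) (b : 'rV[K]_n) (x : 'rV[K]_n) u v :
  f = \sum_i linear_form (row i C) ^+ e.+2 + linear_form (b *m C) ^+ e.+2 ->
  (f^`M(u)^`M(v)).@[x 0] =
  (e.+2 * e.+1)%:R * (C^T *m hessian_form e b (x *m C^T) *m C) u v.
Proof.
move=> fE.
have d2 (l : 'rV[K]_n) : ((linear_form l ^+ e.+2)^`M(u)^`M(v)).@[x 0] =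
    (e.+2 * e.+1)%:R * ((\sum_j l 0 j * x 0 j) ^+ e * (l 0 u * l 0 v)).
  rewrite mderiv_exp mderivZ mderiv_linear_form mulrC mderiv_mulC mderiv_exp mderiv_linear_form.
  rewrite !mevalZ !mevalM !mevalC mevalZ mevalM mevalC rmorphXn /= meval_linear_form.
  by rewrite natrM; ring.
have yE i : (x *m C^T) 0 i = \sum_j row i C 0 j * x 0 j.
  by rewrite mxE; apply: eq_bigr => j _; rewrite !mxE mulrC.
have byE : \sum_i b 0 i * (x *m C^T) 0 i = \sum_j (b *m C) 0 j * x 0 j.
  transitivity ((x *m C^T *m b^T) 0 0).
    by rewrite mxE; apply: eq_bigr => i _; rewrite [b^T _ _]mxE mulrC.
  by rewrite -mulmxA -trmx_mul mxE; apply: eq_bigr => i _; rewrite [_^T _ _]mxE mulrC.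
have fu : f^`M(u) = \sum_i (linear_form (row i C) ^+ e.+2)^`M(u)
                     + (linear_form (b *m C) ^+ e.+2)^`M(u).
  by rewrite {1}fE mderivD raddf_sum.
transitivity (\sum_i ((linear_form (row i C) ^+ e.+2)^`M(u)^`M(v)).@[x 0]
              + ((linear_form (b *m C) ^+ e.+2)^`M(u)^`M(v)).@[x 0]).
  by rewrite fu mderivD raddf_sum /= mevalD raddf_sum.
pose c2 : K := (e.+2 * e.+1)%:R.
transitivity (c2 * (\sum_i (\sum_j row i C 0 j * x 0 j) ^+ e * (row i C 0 u * row i C 0 v)
  + (\sum_j (b *m C) 0 j * x 0 j) ^+ e * ((b *m C) 0 u * (b *m C) 0 v))).
  by rewrite mulrDr mulr_sumr; congr (_ + _); [apply: eq_bigr => i _ |]; exact: d2.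
congr (_ * _).
rewrite /hessian_form mulmxDr mulmxDl [RHS]mxE; congr (_ + _).
  rewrite mul_mx_diag [RHS]mxE; apply: eq_bigr => i _.
  by rewrite -yE !mxE; ring.
rewrite -scalemxAr -scalemxAl [RHS]mxE byE; congr (_ * _).
have -> : C^T *m (b^T *m b) *m C = (b *m C)^T *m (b *m C) by rewrite trmx_mul !mulmxA.
by rewrite outer_productE.
Qed.

(** Both normal forms compute the Hessian of [f], each in its own coordinates. *)
Lemma bordered_forms_comparison (A A' : 'M[K]_n) (b b' : 'rV[K]_n) k k' r (l : 'I_r -> 'rV[K]_n) :
  f = \sum_i linear_form (l i) ^+ e.+2 ->
  A \in unitmx -> A' \in unitmx ->
  linear_subst A f = bordered_fermat e.+2 b ->
  linear_subst A' f = bordered_fermat e.+2 b' ->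
  (forall i : 'I_n, (b 0 i != 0) = (i < k)%N) ->
  (forall i : 'I_n, (b' 0 i != 0) = (i < k')%N) ->
  (0 < k)%N -> (3 <= k')%N -> (k <= n)%N -> (k' <= n)%N -> (k' <= k)%N.
Proof.
move=> fE Au Au' fA fA' bk bk' k0 k3 kn kn'.
have back (M : 'M[K]_n) c : M \in unitmx -> linear_subst M f = bordered_fermat e.+2 c ->
    f = \sum_i linear_form (row i (invmx M)) ^+ e.+2 + linear_form (c *m invmx M) ^+ e.+2.
  move=> Mu fM; rewrite -linear_subst_bordered -fM fE !linear_subst_powers.
  by apply: eq_bigr => i _; rewrite mulmxK.
pose B := invmx A *m A'.
have Bu : B \in unitmx by rewrite unitmx_mul unitmx_inv Au.
apply: (center_comparison e_gt0 Bu bk bk' _ k0 k3 kn kn') => y.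
pose x := y *m A'^T.
have d0 : (e.+2 * e.+1)%:R != 0 :> K by rewrite pnatr_eq0 muln_eq0.
have key : (invmx A)^T *m hessian_form e b (x *m (invmx A)^T) *m invmx A =
           (invmx A')^T *m hessian_form e b' (x *m (invmx A')^T) *m invmx A'.
  apply/matrixP => u v; apply: (mulfI d0).
  by rewrite -(second_derivative _ _ _ (back _ _ Au fA)) (second_derivative _ _ _ (back _ _ Au' fA')).
have xB : x *m (invmx A)^T = y *m B^T by rewrite /x /B trmx_mul mulmxA.
have xy : x *m (invmx A')^T = y by rewrite /x -mulmxA -trmx_mul mulVmx // trmx1 mulmx1.
rewrite xB xy in key.
have := congr1 (fun M => A'^T *m M *m A') key; rewrite !mulmxA.
rewrite -trmx_mul -/B => ->; rewrite -trmx_mul mulVmx // trmx1 mul1mx.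
by rewrite -mulmxA mulVmx // mulmx1.
Qed.

End Uniqueness.

(** * The resultant of the system *)

Section Homogenize.
Variables (q e : nat) (K : numFieldType).
Implicit Types (g : {mpoly K[q]}) (x : 'rV[K]_q.+1).

Lemma homogenize_homog g : (msize g <= e.+1)%N -> homogenize e g \is e.-homog.
Proof.
move=> ge; rewrite /homogenize big_seq; apply: rpred_sum => m mg; apply: rpredZ.
have me : (mdeg m <= e)%N by have := leq_trans (msize_mdeg_lt mg) ge.
have -> : \prod_(i < q) 'X_(lift ord_max i) ^+ m i * 'X_ord_max ^+ (e - mdeg m) =
    'X_[\sum_(i < q) (U_(lift ord_max i) *+ m i)%MM + U_(ord_max) *+ (e - mdeg m)] :> {mpoly K[q.+1]}.
  rewrite mpolyXD -mpolyXn (big_morph _ (@mpolyXD _ K) (@mpolyX0 _ K)); congr (_ * _).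
  by apply: eq_bigr => i _; rewrite mpolyXn.
rewrite dhomogX /= mdegD mdeg_sum mdegMn mdeg1 mul1n.
under eq_bigr do rewrite mdegMn mdeg1 mul1n.
by rewrite -mdegE subnKC.
Qed.

Lemma homogenize_eval g x : (msize g <= e.+1)%N -> x 0 ord_max != 0 ->
  (homogenize e g).@[x 0] =
  x 0 ord_max ^+ e * g.@[fun i => x 0 (lift ord_max i) / x 0 ord_max].
Proof.
move=> ge x0; rewrite /homogenize raddf_sum /= mevalE mulr_sumr.
rewrite !big_seq; apply: eq_bigr => m mg.
have me : (mdeg m <= e)%N by have := leq_trans (msize_mdeg_lt mg) ge.
rewrite mevalZ mevalM rmorph_prod rmorphXn /= mevalXU [RHS]mulrCA; congr (_ * _).
under eq_bigr do rewrite rmorphXn /= mevalXU.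
under [in RHS]eq_bigr do rewrite expr_div_n.
rewrite big_split /= prodfV prodrXr -mdegE [RHS]mulrCA; congr (_ * _).
by rewrite -[in RHS](subnKC me) exprD mulrC mulKf // expf_neq0.
Qed.

(** On the hyperplane at infinity only the top degree part survives. *)
Lemma homogenize_binomial (c c' : K) (i : 'I_q) x : (0 < e)%N -> x 0 ord_max = 0 ->
  (homogenize e (c *: 'X_i ^+ e - c'%:MP)).@[x 0] = c * x 0 (lift ord_max i) ^+ e.
Proof.
move=> e0 x0; set g := c *: _ - _.
pose h (m : 'X_{1..q}) : K := \prod_(k < q) x 0 (lift ord_max k) ^+ m k * x 0 ord_max ^+ (e - mdeg m).
have -> : (homogenize e g).@[x 0] = \sum_(m <- msupp g) g@_m * h m.
  rewrite raddf_sum; apply: eq_bigr => m _.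
  rewrite /= mevalZ mevalM rmorph_prod rmorphXn /= mevalXU; congr (_ * (_ * _)).
  by apply: eq_bigr => k _; rewrite rmorphXn /= mevalXU.
have gE m : g@_m = c *+ (m == (U_(i) *+ e)%MM) - c' *+ (m == 0%MM).
  rewrite mcoeffB mcoeffZ mpolyXn mcoeffX mcoeffC !mulr_natr.
  by rewrite [_ == m]eq_sym.
have hU : h (U_(i) *+ e)%MM = x 0 (lift ord_max i) ^+ e.
  rewrite /h mdegMn mdeg1 mul1n subnn expr0 mulr1 (bigD1 i) //= mulmnE mnm1E eqxx mul1n.
  by rewrite big1 ?mulr1 // => k /negbTE ki; rewrite mulmnE mnm1E eq_sym ki expr0.
have h0 m : (mdeg m < e)%N -> h m = 0.
  by move=> me; rewrite /h x0 expr0n gtn_eqF ?mulr0 // subn_gt0.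
have U0 : (U_(i) *+ e)%MM != 0%MM :> 'X_{1..q}.
  by rewrite -mdeg_eq0 mdegMn mdeg1 mul1n -lt0n.
have [ug|ug] := boolP ((U_(i) *+ e)%MM \in msupp g); last first.
  have := gE (U_(i) *+ e)%MM; rewrite (memN_msupp_eq0 ug) eqxx (negbTE U0) subr0 => c0.
  rewrite [c](esym c0) mul0r big1 // => m _; rewrite gE.
  rewrite [c](esym c0) mul0rn sub0r; case: eqP => [->|_]; last by rewrite oppr0 mul0r.
  by rewrite h0 ?mulr0 // mdeg0.
rewrite (bigD1_seq _ ug) //= hU gE eqxx (negbTE U0) subr0 big1 ?addr0 // => m mU.
rewrite gE (negbTE mU) sub0r; case: eqP => [->|_]; last by rewrite oppr0 mul0r.
by rewrite h0 ?mulr0 // mdeg0.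
Qed.

End Homogenize.

Section SystemResultant.
Variables (q e : nat) (K : numClosedFieldType) (a : 'rV[K]_q.+1).
Hypotheses (e_gt0 : (0 < e)%N) (a_neq0 : forall j, a 0 j != 0).

Lemma msize_exp_le n (p : {mpoly K[n]}) k : (msize p <= 2)%N -> (msize (p ^+ k) <= k.+1)%N.
Proof.
move=> p2; elim: k => [|k IH]; first by rewrite expr0 msize1.
rewrite exprS; have [->|p0] := eqVneq p 0; first by rewrite mul0r mmeasure0.
have pk0 : p ^+ k != 0 by rewrite expf_neq0.
rewrite (msizeM p0 pk0) (mpolySpred _ p0) addSn /=.
by apply: (leq_add _ IH : _ <= 1 + _)%N; rewrite -ltnS -mpolySpred.
Qed.

Lemma msize_system j : (msize (system e.+1 a j) <= e.+1)%N.
Proof.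
have X2 n (i : 'I_n) : (msize ('X_i : {mpoly K[n]}) <= 2)%N by rewrite msizeX mdeg1.
have C1 n (c : K) : (msize (c%:MP_[n]) <= 1)%N by rewrite msizeC; case: eqP.
rewrite /system; case: unliftP => [i _|_].
  apply: leq_trans (msizeD_le _ _) _; rewrite geq_max; apply/andP; split.
    by apply: leq_trans (msizeZ_le _ _) _; apply: msize_exp_le.
  by rewrite mmeasureN; apply: leq_trans (C1 _ _) _.
apply: leq_trans (msizeD_le _ _) _; rewrite geq_max msize1 andbT.
apply: leq_trans (msizeZ_le _ _) _; apply: msize_exp_le.
apply: leq_trans (msizeD_le _ _) _; rewrite geq_max; apply/andP; split; last first.
  exact: leq_trans (C1 _ _) _.
apply: leq_trans (msize_sum _ _ _) _; apply/bigmax_leqP_seq => i _ _.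
exact: leq_trans (msizeZ_le _ _) _.
Qed.

(** The first equations of the homogenized system have no common zero at infinity,
    so its nontrivial zeros are the solutions of the system up to scaling. *)
Lemma resultant_system_zero (Res : {mpoly int[#|coef_index q.+1 e|]}) :
  is_resultant K Res ->
  (resultant_value Res (fun j => homogenize e (system e.+1 a j)) = 0 :> K <->
   exists u, solution e.+1 a u).
Proof.
move=> [resP _ _]; rewrite resP; last by move=> j; apply/homogenize_homog/msize_system.
split=> [[x x0 hx]|[u su]].
  have xm : x 0 ord_max != 0.
    apply: contra_neq x0 => xm; apply/rowP => j; rewrite mxE.
    case: (unliftP ord_max j) => [i ->|-> //].
    have := hx (lift ord_max i); rewrite /system liftK /= homogenize_binomial //.
    by move=> /eqP; rewrite mulf_eq0 (negbTE (a_neq0 _)) expf_eq0 e_gt0 => /eqP.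
  exists (\row_i (x 0 (lift ord_max i) / x 0 ord_max)) => j.
  have := hx j; rewrite homogenize_eval ?msize_system // => /eqP.
  rewrite mulf_eq0 expf_eq0 (negbTE xm) andbF /= => /eqP <-.
  by apply: meval_eq => i; rewrite mxE.
pose x : 'rV[K]_q.+1 := \row_j if unlift ord_max j is Some i then u 0 i else 1.
have xm : x 0 ord_max = 1 by rewrite mxE unlift_none.
exists x; first by apply/eqP => /rowP/(_ ord_max); rewrite xm mxE => /eqP; rewrite oner_eq0.
move=> j; rewrite homogenize_eval ?msize_system ?xm ?oner_eq0 // expr1n mul1r -[RHS](su j).
by apply: meval_eq => i; rewrite mxE liftK divr1.
Qed.

End SystemResultant.

(** * The main theorem *)

Lemma pad_neq0 n (K : numFieldType) q (a : 'rV[K]_q.+1) (i : 'I_n) :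
  (forall j, a 0 j != 0) -> (pad n a 0 i != 0) = (i < q.+1)%N.
Proof. by move=> a0; rewrite mxE ltnS; case: leqP => _; rewrite ?a0 ?eqxx. Qed.

Lemma normal_form_unique n d (K : numClosedFieldType) (f : {mpoly K[n]})
    k k' (A A' : 'M[K]_n) (a : 'rV[K]_k.-1.+1) (a' : 'rV[K]_k'.-1.+1) r :
  sum_of_powers d f r -> (3 <= d)%N -> (2 <= k <= n)%N -> (2 <= k' <= n)%N ->
  has_normal_form d f A a -> has_normal_form d f A' a' -> (k' <= k)%N.
Proof.
move=> [l fE] d3 /andP[k2 kn] /andP[k2' kn'] [Au a0 fA] [Au' a0' fA'].
have dE : d = (d - 2).+2 by rewrite -{1}(subnK (ltnW d3)) addn2.
have e0 : (0 < d - 2)%N by rewrite subn_gt0.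
rewrite leqNgt; apply/negP => kk'.
suff : (k' <= k)%N by rewrite leqNgt kk'.
rewrite !normal_formE in fA fA'; rewrite dE in fE fA fA'.
apply: (bordered_forms_comparison e0 fE Au Au' fA fA') => //.
- by move=> i; rewrite pad_neq0 // prednK // ltnW.
- by move=> i; rewrite pad_neq0 // prednK // ltnW.
- exact: ltnW.
- exact: leq_ltn_trans kk'.
Qed.

Lemma normal_form_geometry N q e (K : numClosedFieldType) (a : 'rV[K]_q.+1) :
  (1 < e)%N -> (q <= N)%N -> (forall j, a 0 j != 0) ->
  let F := normal_form N.+1 e.+1 a in
  [/\ forall Res : {mpoly int[#|coef_index q.+1 e|]},
        is_resultant K Res ->
        (singular F <->
         resultant_value Res (fun j => homogenize e (system e.+1 a j)) = 0),
      (singular F ->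
         forall p, singular_point F p ->
         isolated_singularity F p /\ has_type_A q e.+1 F p) /\
      ((4 <= N.+1)%N -> irreducible_mpoly F) &
      (forall p, singular_point F p <->
         exists2 u, solution e.+1 a u & proj_eq (point_of_solution N.+1 u) p) /\
      exists S, [/\ number_of_solutions e.+1 a S,
        milnor_number F (S * e ^ (N - q))%N &
        tjurina_number F (S * e ^ (N - q))%N]].
Proof.
move=> e1 qN a0 F; have e0 := ltnW e1.
split.
- move=> Res /(resultant_system_zero e0 a0) ->; split=> [[p]|[u su]].
    by move/(singular_pointP e1 qN a0) => [u su _]; exists u.
  by exists (point_of_solution N.+1 u); apply: solution_singular.
- split; last by move=> N3; apply: normal_form_irreducible.
  move=> _ p sp; split; first exact: singular_isolated.
  exact: singular_type_A.
split; first exact: singular_pointP.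
have [S hS] := solutions_finite e0 a0; exists S; split=> //.
  by apply: total_number => // p; apply: singular_milnor.
by apply: total_number => // p; apply: singular_tjurina.
Qed.

Theorem theorem2p4 (R : realType) (n d : nat) (f : {mpoly R[i][n]})
  (n_ge3 : (3 <= n)%N) (f_homog : f \is d.-homog) (f_reduced : reduced f)
  (f_essential : essentially_involves_all f)
  (f_rank : waring_rank d f n.+1) :
  (exists! k : nat, (2 <= k <= n)%N /\
     exists (A : 'M[R[i]]_n) (a : 'rV[R[i]]_k.-1.+1), has_normal_form d f A a) /\
  forall (k : nat) (A : 'M[R[i]]_n) (a : 'rV[R[i]]_k.-1.+1),
  (2 <= k <= n)%N -> has_normal_form d f A a ->
  let F := normal_form n d a in
  [/\ forall Res : {mpoly int[#|coef_index k.-1.+1 d.-1|]},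
        is_resultant R[i] Res ->
        (singular F <->
         resultant_value Res (fun j => homogenize d.-1 (system d a j)) = 0),
      (singular F ->
         forall p, singular_point F p ->
         isolated_singularity F p /\ has_type_A k.-1 d F p) /\
      ((4 <= n)%N -> irreducible_mpoly F) &
      (forall p, singular_point F p <->
         exists2 u, solution d a u & proj_eq (point_of_solution n u) p) /\
      exists N, [/\ number_of_solutions d a N,
        milnor_number F (N * d.-1 ^ (n - k))%N &
        tjurina_number F (N * d.-1 ^ (n - k))%N]].
Proof.
have d3 := waring_degree_ge3 n_ge3 f_essential f_rank.
have [f_powers _] := f_rank.
split.
  have [k [k2n [A [a fA]]]] := normal_form_exists n_ge3 f_essential f_rank.
  exists k; split; first by split=> //; exists A, a.
  move=> k' [k2n' [A' [a' fA']]]; apply/eqP; rewrite eqn_leq.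
  apply/andP; split.
    exact: (normal_form_unique f_powers d3 k2n' k2n fA' fA).
  exact: (normal_form_unique f_powers d3 k2n k2n' fA fA').
clear f_homog f_reduced f_essential f_rank f_powers.
case: n d n_ge3 d3 f => [//|N] [//|e] n_ge3 d3 f [//|q] A a /andP[_ qN] [_ a0 _].
exact: normal_form_geometry.
Qed.
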